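(* Let $Y \neq \{0\}$ be a real Banach space with the Daugavet property. Then there exist convex closed bounded symmetric sets $C_1, C_2 \subset Y$ which are SCD but whose Minkowski sum $C_1 + C_2$ is not SCD. If $Y$ is separable, such $C_1, C_2$ can be chosen to be bodies, i.e. to have non-empty interior.
   Context: All Banach spaces are real. A set $C$ is symmetric if $-C=C$. For a non-empty bounded set $A \subset Y$, a slice of $A$ is a (non-empty) set of the form $S(A,x^*,\varepsilon)=\{x\in A : x^*(x) > \sup_{a\in A} x^*(a)-\varepsilon\}$ with $x^*\in Y^*\setminus\{0\}$ and $\varepsilon>0$. A sequence $(U_n)_{n\in\mathbb N}$ of non-empty subsets of a bounded set $A\subset Y$ is called determining (for $A$) if for every $B\subset Y$ with $B\cap U_n\neq\emptyset$ for all $n$ one has $A\subset\overline{\mathrm{conv}}(B)$ (norm-closed convex hull). A bounded set $A$ is SCD (slicely countably determined) if it has a determining sequence consisting of slices of $A$. A Banach space $Y$ has the Daugavet property if every bounded linear rank-one operator $T\colon Y\to Y$ satisfies $\|I+T\|=1+\|T\|$. The Minkowski sum is $C_1+C_2=\{c_1+c_2: c_1\in C_1, c_2\in C_2\}$. *)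

(* Defs.v *)
From HB Require Import structures.
From mathcomp Require Import all_boot all_order all_algebra.
From mathcomp Require Import all_classical all_reals all_analysis.

Set Implicit Arguments.
Unset Strict Implicit.
Unset Printing Implicit Defensive.

Import Order.TTheory GRing.Theory Num.Theory.
Import numFieldNormedType.Exports.

Local Open Scope classical_set_scope.
Local Open Scope ring_scope.

Section NormedModule.
Variables (R : realType) (Y : normedModType R).
Implicit Types (A B S C : set Y).

Definition symmetric_set C := -%R @` C = C.

Definition minkowski_sum A B : set Y := [set a + b | a in A & b in B].

Definition closed_convex_hull B : set Y := closure (smallest (@convex_set R Y) B).

Definition slice A (f : Y -> R) (e : R) : set Y :=
  [set x | A x /\ sup (f @` A) - e < f x].

(* Y^* \ {0} is the set of nonzero continuous linear functionals. For A bounded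
   and nonempty, sup is the genuine supremum and a slice is never empty. *)
Definition is_slice A S :=
  exists (f : {linear Y -> R^o}) (e : R),
    [/\ continuous f, exists y, f y != 0, 0 < e & S = slice A f e].

Definition determining A (U : nat -> set Y) :=
  (forall n, U n !=set0 /\ U n `<=` A) /\
  forall B, (forall n, B `&` U n !=set0) -> A `<=` closed_convex_hull B.

(* The empty set is not SCD, since determining sets are nonempty. *)
Definition SCD A :=
  bounded_set A /\
  exists U : nat -> set Y, (forall n, is_slice A (U n)) /\ determining A U.

Definition opnorm (T : Y -> Y) : R := sup [set `|T x| | x in [set x | `|x| <= 1]].

Definition rank_one (T : Y -> Y) :=
  exists2 e : Y, e != 0 & range T = [set a *: e | a in [set: R]].

Definition Daugavet_property :=
  forall T : {linear Y -> Y}, bounded_fun_norm T -> rank_one T ->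
    opnorm (fun x => x + T x) = 1 + opnorm T.

Definition convex_closed_bounded_symmetric C :=
  [/\ convex_set C, closed C, bounded_set C & symmetric_set C].

Definition separable := exists2 D : set Y, countable D & dense D.

End NormedModule.

Arguments Daugavet_property {R} Y.
Arguments separable {R} Y.

(* Main.v *)
From HB Require Import structures.
Require Import Defs.
From mathcomp Require Import all_boot all_order all_algebra.
From mathcomp Require Import all_classical all_reals all_analysis.
From mathcomp Require Import ring lra.

Set Implicit Arguments.
Unset Strict Implicit.
Unset Printing Implicit Defensive.

Import Order.TTheory GRing.Theory Num.Theory.
Import numFieldNormedType.Exports.

Local Open Scope classical_set_scope.
Local Open Scope ring_scope.

(** The construction rests on the Daugavet property in the following form: for
    every continuous functional f, every z in the unit ball, every y and every
    e > 0, some x in the unit ball satisfies f x >= f z - e and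
    |y - x| >= |y| + 1 - e ([daugavet_in], applied to the whole space in
    [daugavet_setT]).  This form passes to kernels of functionals
    ([daugavet_in_kernel]).  Hence Y splits as W + span(e1, e2), where W is the
    common kernel of functionals phi1, phi2 dual to e1, e2, and W still has
    the property.

    Separability is forced on an SCD set, so the next step is to find inside
    the unit sphere of W a sequence u, symmetric as a set, such that the slices
    of its closed convex hull K contain points u m that are almost l1-orthogonal
    to any given finite sum of terms of u ([exists_daugavet_sequence]).  Closing
    a countable set under countably many choices produces it; if Y is separable, u can be
    made dense enough for K to be the unit ball of W ([dense_daugavet_sequence]).

    With s_n = 2^-n, and k(n) taking every value infinitely often, put
      a_n = (1 - s_n^2) u_k(n) + (1 - s_n) e1 + s_n e2,
    let C1 be the closed convex hull of all a_n and - a_n, and let C2 be the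
    same set with e1 and e2 exchanged.

    C1 is SCD because every a_n is strongly exposed ([vertex_exposed]): take f
    equal on W to a functional norming u_k(n), with f e1 = 0 and f e2 = 2 s_n.
    Then f a_j <= 1 - s_j^2 + 2 s_n s_j = f a_n - (s_j - s_n)^2.  The slices
    defined by f and - f shrink to the points +a_n, -a_n,
    and these points span C1 ([SCD_exposed]).

    C1 + C2 is not SCD.  Since the e-components of the a_n lie on the segment
    from e1 to e2, any f with |f e2| <= |f e1| has the same supremum over C1 as
    over its faces K + e1 and - (K + e1) ([summand_slice]), and any other f
    behaves in this way on C2.  So every slice of C1 + C2, whatever its
    functional, contains u m + v with a fixed v and u m almost orthogonal to
    any given finite sum ([sum_slice]).  From the n-th slice one can therefore
    choose b_n = x_n + v_n such that |u_0 - x_0 - ... - x_(n-1)| >= n + 1/2 for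
    all n.  Then every convex combination q of the x_n satisfies
    |2 u_0 - q| >= 2, whereas the projection onto W along e1, e2 maps every
    v_n into the unit ball.  So the point (u_0 + e1) + (u_0 + e2) of C1 + C2 is
    not in the closed convex hull of the b_n ([sum_not_SCD]). *)

(** * Functionals and closed convex hulls *)

Section Convexity.
Variables (R : realType) (Y : normedModType R).
Implicit Types (A B : set Y) (f g : Y -> R).

(** Continuous linear functionals as plain functions, so that linear
    combinations of them need no repackaging. *)
Definition functional f :=
  (forall (a : R) x y, f (a *: x + y) = a * f x + f y) /\
  exists k, forall x, `|f x| <= k * `|x|.

Lemma functionalD f x y : functional f -> f (x + y) = f x + f y.
Proof. by case=> fl _; rewrite -{1}[x]scale1r fl mul1r. Qed.

Lemma functional0 f : functional f -> f 0 = 0.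
Proof. by move=> /(functionalD 0 0); rewrite addr0; lra. Qed.

Lemma functionalZ f a x : functional f -> f (a *: x) = a * f x.
Proof. by move=> ff; rewrite -{1}[_ *: _]addr0 ff.1 functional0// addr0. Qed.

Lemma functionalN f x : functional f -> f (- x) = - f x.
Proof. by move=> ff; rewrite -scaleN1r functionalZ// mulN1r. Qed.

Lemma functionalB f x y : functional f -> f (x - y) = f x - f y.
Proof. by move=> ff; rewrite functionalD// functionalN. Qed.

Lemma functional_comb f g a : functional f -> functional g ->
  functional (fun x => f x + a * g x).
Proof.
move=> [fl [k fk]] [gl [l gl']]; split=> [b x y|].
  by rewrite fl gl; ring.
exists (k + `|a| * l) => x; rewrite (le_trans (ler_normD _ _))// mulrDl lerD//.
by rewrite normrM -mulrA ler_wpM2l.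
Qed.

Lemma functional_zero : functional (fun=> 0).
Proof.
split=> [a x y|]; first by rewrite mulr0 addr0.
by exists 0 => x; rewrite normr0 mul0r.
Qed.

Lemma functional_scale a f : functional f -> functional (fun x => a * f x).
Proof.
move=> /(functional_comb a functional_zero).
by under [X in functional X -> _]eq_fun do rewrite add0r.
Qed.

Lemma functional_linear f : functional f ->
  exists2 h : {linear Y -> R^o}, continuous h & h =1 f.
Proof.
move=> ff; have [fl [k fk]] := ff.
have hl : linear (f : Y -> R^o) by move=> a x y; rewrite fl.
pose h : {linear Y -> R^o} :=
  HB.pack (f : Y -> R^o) (GRing.isLinear.Build _ _ _ _ _ hl).
exists h => //; apply: bounded_linear_continuous.
apply/linear_boundedP; exists k; split; first exact: num_real.
move=> r /ltW kr x; rewrite (le_trans (fk x))//; exact: ler_wpM2r.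
Qed.

Lemma linear_functional (h : {linear Y -> R^o}) : continuous h -> functional h.
Proof.
move=> /linear_bounded_continuous/linear_boundedP hb; split=> [a x y|].
  by rewrite linearP.
have [k [_ kP]] := hb; exists (k + 1) => x.
by apply: kP; rewrite ltrDl.
Qed.

Lemma convex_setP A : convex_set A <->
  forall x y (t : R), A x -> A y -> 0 <= t <= 1 -> A (t *: x + (1 - t) *: y).
Proof.
split=> [cA x y t Ax Ay t01|cA x y t /set_mem Ax /set_mem Ay].
  have t01' : (Itv.spec (@Itv.num_sem R) (Itv.Real `[0%Z, 1%Z]) t).
    by apply/and3P; split; rewrite ?num_real// ?in_itv/= ?bnd_simp; case/andP: t01.
  apply: (set_mem (cA x y (Itv.mk t01') _ _)); exact: mem_set.
by apply: mem_set; apply: cA => //; rewrite ge0 le1.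
Qed.

Lemma closureP A x :
  closure A x <-> forall e, 0 < e -> exists2 a, A a & `|x - a| < e.
Proof.
split=> [Ax e e0|Ax B /nbhs_ballP[e/= e0 eB]].
  have [|a [Aa]] := Ax (ball x e); first exact: nbhsx_ballx.
  by rewrite -ball_normE/= => xa; exists a.
have [a Aa xa] := Ax _ e0; exists a; split=> //; apply: eB.
by rewrite -ball_normE.
Qed.

Lemma closure_convex A : convex_set A -> convex_set (closure A).
Proof.
move=> /convex_setP cA; apply/convex_setP => x y t /closureP Ax /closureP Ay t01.
apply/closureP => e e0.
have [a Aa xa] := Ax _ e0; have [b Ab yb] := Ay _ e0.
exists (t *: a + (1 - t) *: b); first exact: cA.
rewrite opprD addrACA -!scalerBr (le_lt_trans (ler_normD _ _))//.
rewrite !normrZ.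
have [t0 t1] := andP t01; rewrite (ger0_norm t0) ger0_norm ?subr_ge0//.
move: xa yb; set u := `|x - a|; set v := `|y - b| => ue ve.
case: (leP u v) => [uv|/ltW vu]; [apply: le_lt_trans ve|apply: le_lt_trans ue]; nra.
Qed.

Lemma convex_hull_convex A : convex_set (smallest (@convex_set R Y) A).
Proof.
apply/convex_setP => x y t Ax Ay t01 B [cB AB].
by apply: (convex_setP B).1 => //; [apply: Ax|apply: Ay].
Qed.

Lemma cch_convex A : convex_set (closed_convex_hull A).
Proof. exact/closure_convex/convex_hull_convex. Qed.

Lemma cch_closed A : closed (closed_convex_hull A).
Proof. exact: closed_closure. Qed.

Lemma sub_cch A : A `<=` closed_convex_hull A.
Proof. by apply: subset_trans (@subset_closure _ _); exact: sub_gen_smallest. Qed.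

Lemma cch_sub A B : convex_set B -> closed B -> A `<=` B ->
  closed_convex_hull A `<=` B.
Proof.
move=> cB clB AB; rewrite [X in _ `<=` X](closure_id B).1//.
by apply: closure_subset; exact: smallest_sub.
Qed.

Lemma cch_mono A B : A `<=` B -> closed_convex_hull A `<=` closed_convex_hull B.
Proof.
by move=> AB; apply: cch_sub (subset_trans AB (@sub_cch _));
  [exact: cch_convex|exact: cch_closed].
Qed.

Lemma closedP A : (forall x, closure A x -> A x) -> closed A.
Proof. by []. Qed.

Lemma closed_sublevel (N : Y -> R) (k m : R) :
  (forall x y, N x - N y <= k * `|x - y|) -> closed [set x | N x <= m].
Proof.
move=> Nk; apply: closedP => x /closureP Ax /=.
rewrite leNgt; apply/negP => mx.
have k0 : 0 < `|k| + 1 by rewrite ltr_wpDl.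
have [|a /= Na xa] := Ax ((N x - m) / (`|k| + 1)).
  by rewrite divr_gt0// subr_gt0.
have : N x - N a <= (`|k| + 1) * `|x - a|.
  rewrite (le_trans (Nk _ _))// ler_wpM2r// (le_trans (ler_norm _))//.
  by rewrite lerDl.
move: xa; rewrite ltr_pdivlMr// mulrC => xa h; lra.
Qed.

Lemma closed_halfspace f m : functional f -> closed [set x | f x <= m].
Proof.
move=> ff; have [_ [k fk]] := ff; apply: (@closed_sublevel _ k) => x y.
by rewrite -functionalB// (le_trans (ler_norm _)).
Qed.

Lemma convex_halfspace f m : functional f -> convex_set [set x | f x <= m].
Proof.
move=> ff; apply/convex_setP => x y t /= fx fy /andP[t0 t1].
rewrite ff.1 functionalZ//; nra.
Qed.

Lemma cch_halfspace f m A : functional f -> (forall a, A a -> f a <= m) ->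
  forall x, closed_convex_hull A x -> f x <= m.
Proof.
move=> ff Am x.
have Am' : A `<=` [set y | f y <= m] by [].
have h := cch_sub (convex_halfspace ff) (closed_halfspace ff) Am'; exact: h.
Qed.

End Convexity.

(** * Separation of convex sets *)

Section HahnBanach.
Variables (R : realType) (V : lmodType R).
Implicit Types (p q : V -> R) (x y v : V).

Definition sublinear p :=
  (forall x y, p (x + y) <= p x + p y) /\
  (forall (t : R) x, 0 < t -> p (t *: x) = t * p x).

Lemma sublinear0 p : sublinear p -> p 0 = 0.
Proof.
move=> [_ pZ]; have /eqP := pZ 2%:R 0 ltac:(by []).
by rewrite scaler0 mulr_natl mulr2n -subr_eq0 opprD addrA subrr sub0r oppr_eq0 => /eqP.
Qed.

Lemma sublinearN p x : sublinear p -> - p (- x) <= p x.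
Proof.
move=> sp; have := sp.1 (- x) x.
rewrite addNr sublinear0//; lra.
Qed.

(** The largest sublinear map q <= p with q (- k) <= - r for all (k, r) in
    K, if K is a convex cone on which r <= p k. *)
Definition conic_inf p (K : set (V * R)) x :=
  inf [set p (x + k.1) - k.2 | k in K].

Definition convex_cone (K : set (V * R)) :=
  [/\ K (0, 0),
      forall k l, K k -> K l -> K (k.1 + l.1, k.2 + l.2) &
      forall (t : R) k, 0 < t -> K k -> K (t *: k.1, t * k.2)].

Section ConicInf.
Variables (p : V -> R) (K : set (V * R)).
Hypotheses (sp : sublinear p) (cK : convex_cone K).
Hypothesis (pK : forall k, K k -> k.2 <= p k.1).

Lemma conic_inf_lb x k : K k -> - p (- x) <= p (x + k.1) - k.2.
Proof.
move=> Kk; have := sp.1 (- x) (x + k.1); rewrite addKr => h.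
have := pK Kk; lra.
Qed.

Lemma conic_inf_has_inf x : has_inf [set p (x + k.1) - k.2 | k in K].
Proof.
split; first by exists (p (x + 0) - 0), (0, 0) => //; case: cK.
by exists (- p (- x)) => _ [k Kk <-]; exact: conic_inf_lb.
Qed.

Lemma conic_inf_le x k : K k -> conic_inf p K x <= p (x + k.1) - k.2.
Proof.
by move=> Kk; apply: ge_inf; [exact: (conic_inf_has_inf x).2|exists k].
Qed.

Lemma le_conic_inf x m :
  (forall k, K k -> m <= p (x + k.1) - k.2) -> m <= conic_inf p K x.
Proof.
move=> mP; apply: lb_le_inf; first exact: (conic_inf_has_inf x).1.
by move=> _ [k Kk <-]; exact: mP.
Qed.

Lemma conic_inf_le_id x : conic_inf p K x <= p x.
Proof. by have [K0 _ _] := cK; have := conic_inf_le x K0; rewrite addr0 subr0. Qed.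

Lemma conic_inf_sublinear : sublinear (conic_inf p K).
Proof.
have [K0 KD KZ] := cK.
have le t x : 0 < t -> conic_inf p K (t *: x) <= t * conic_inf p K x.
  move=> t0; rewrite -ler_pdivrMl//; apply: le_conic_inf => k Kk.
  rewrite ler_pdivrMl// mulrBr -sp.2// scalerDr.
  exact: (conic_inf_le _ (KZ _ _ t0 Kk)).
split=> [x y|t x t0].
  rewrite -lerBlDr; apply: le_conic_inf => k Kk.
  rewrite lerBlDl -lerBlDr; apply: le_conic_inf => l Kl.
  have := conic_inf_le (x + y) (KD _ _ Kk Kl) => /= h.
  have := sp.1 (x + k.1) (y + l.1); rewrite addrACA; lra.
apply/eqP; rewrite eq_le le//= -ler_pdivlMl//.
by have := le t^-1 (t *: x); rewrite scalerA mulVf ?gt_eqF// scale1r; apply; rewrite invr_gt0.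
Qed.

Lemma conic_inf_cone k : K k -> conic_inf p K (- k.1) <= - k.2.
Proof.
by move=> /(conic_inf_le (- k.1)); rewrite addNr sublinear0// sub0r.
Qed.

End ConicInf.

(** The pointwise infimum of a chain of sublinear maps below p is sublinear,
    because p bounds each of them from below by x |-> - p (- x); so Zorn
    applies. *)
Lemma minimal_sublinear p : sublinear p ->
  exists q, [/\ sublinear q, forall x, q x <= p x &
    forall r, sublinear r -> (forall x, r x <= q x) -> r = q].
Proof.
move=> sp.
pose T := {q | sublinear q /\ forall x, q x <= p x}.
(* The order is reversed, so that a maximal element is a minimal sublinear
   map. *)
pose rel_T (q r : T) := `[< forall x, sval r x <= sval q x >].
have [|q r s /asboolP qr /asboolP rs|q r /asboolP qr /asboolP rq|A totA|q qmin] :=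
    @Zorn T rel_T.
- by move=> q; apply/asboolP.
- by apply/asboolP => x; exact: le_trans (rs x) (qr x).
- case: q r qr rq => [q hq] [r hr] /= qr rq.
  have E : q = r by apply/funext => x; apply/eqP; rewrite eq_le rq qr.
  by subst r; congr exist; exact: Prop_irrelevance.
- have [[q0 Aq0]|A0] := pselect (A !=set0); last first.
    by exists (exist _ p (conj sp (fun=> lexx _))) => s As; case: A0; exists s.
  have lbA x : has_lbound [set sval q x | q in A].
    exists (- p (- x)) => _ [q Aq <-].
    rewrite (le_trans _ (sublinearN x (svalP q).1))// lerN2.
    exact: (svalP q).2.
  have infA x : has_inf [set sval q x | q in A].
    by split=> //; exists (sval q0 x), q0.
  pose r x := inf [set sval q x | q in A].
  have r_le (q : T) x : A q -> r x <= sval q x.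
    by move=> Aq; apply: ge_inf => //; exists q.
  have le_r m x : (forall q : T, A q -> m <= sval q x) -> m <= r x.
    by move=> mP; apply: lb_le_inf; [exact: (infA x).1|move=> _ [q Aq <-]; exact: mP].
  have rZ t x : 0 < t -> r (t *: x) <= t * r x.
    move=> t0; rewrite -ler_pdivrMl//; apply: (le_r) => q Aq.
    by rewrite ler_pdivrMl// -(svalP q).1.2//; exact: r_le.
  have sr : sublinear r.
    split=> [x y|t x t0].
      rewrite -lerBlDr; apply: (le_r) => q Aq.
      rewrite lerBlDl -lerBlDr; apply: (le_r) => s As.
      have [/asboolP qs|/asboolP sq] := totA q s Aq As.
        have := r_le s (x + y) As; have := (svalP s).1.1 x y.
        have := qs x; lra.
      have := r_le q (x + y) Aq; have := (svalP q).1.1 x y.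
      have := sq y; lra.
    apply/eqP; rewrite eq_le rZ//= -ler_pdivlMl//.
    by have := rZ t^-1 (t *: x); rewrite scalerA mulVf ?gt_eqF// scale1r; apply; rewrite invr_gt0.
  have rp x : r x <= p x by rewrite (le_trans (r_le _ x Aq0))//; exact: (svalP q0).2.
  exists (exist _ r (conj sr rp)) => s As.
  by apply/asboolP => x /=; exact: r_le.
exists (sval q); split; [exact: (svalP q).1|exact: (svalP q).2|].
move=> r sr rq.
have rp x : r x <= p x by rewrite (le_trans (rq x))//; exact: (svalP q).2.
by rewrite -(qmin (exist _ r (conj sr rp)))//; apply/asboolP.
Qed.

(** A minimal sublinear map q is linear: the conic infimum of q over the ray
    through (y, q y) is sublinear and below q, hence equal to q, and this
    says that q x + q y <= q (x + y). *)
Lemma hahn_banach p : sublinear p ->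
  exists2 h : V -> R, (forall (a : R) x y, h (a *: x + y) = a * h x + h y) &
    forall x, h x <= p x.
Proof.
move=> /minimal_sublinear[q [sq qp qmin]]; exists q => //.
have qD x y : q (x + y) = q x + q y.
  apply/eqP; rewrite eq_le sq.1/=.
  pose K := [set (t *: y, t * q y) | t in [set t : R | 0 <= t]].
  have cK : convex_cone K.
    split; first by exists 0 => //=; rewrite scale0r mul0r.
      move=> _ _ [t /= t0 <-] [u /= u0 <-]; exists (t + u) => /=.
        by rewrite addr_ge0.
      by rewrite scalerDl mulrDl.
    move=> t _ t0 [u /= u0 <-]; exists (t * u) => /=; first by rewrite mulr_ge0// ltW.
    by rewrite scalerA mulrA.
  have qK k : K k -> k.2 <= q k.1.
    move=> [t /= ]; rewrite le_eqVlt => /predU1P[<-|t0] <- /=.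
      by rewrite scale0r mul0r sublinear0.
    by rewrite sq.2.
  have E := qmin _ (conic_inf_sublinear sq cK qK) (conic_inf_le_id sq cK qK).
  have Ky : K (y, q y) by exists 1 => /=; rewrite ?scale1r ?mul1r.
  by have := conic_inf_le sq cK qK x Ky; rewrite E /= lerBrDr.
have q0 := sublinear0 sq.
have qN x : q (- x) = - q x.
  by apply/eqP; rewrite -subr_eq0 opprK -qD addNr q0.
have qZ a x : q (a *: x) = a * q x.
  have [a0|a0|->] := ltrgtP a 0; last by rewrite scale0r mul0r.
    rewrite -[a]opprK scaleNr qN sq.2 ?oppr_gt0//; ring.
  by rewrite sq.2.
by move=> a x y; rewrite qD qZ.
Qed.

End HahnBanach.

Section Separation.
Variables (R : realType) (Y : normedModType R).

Lemma norm_sublinear : sublinear (fun x : Y => `|x|).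
Proof.
split=> [x y|t x t0]; first exact: ler_normD.
by rewrite normrZ gtr0_norm.
Qed.

(** The conic infimum of the norm over the cone generated by the (c - z, r),
    c in C, is sublinear exactly because C stays at distance r from z; a
    linear map below it separates with gap r. *)
Lemma separation (C : set Y) z r : convex_set C -> C !=set0 -> 0 <= r ->
  (forall c, C c -> r <= `|c - z|) ->
  exists f : Y -> R, [/\ functional f, forall x, `|f x| <= `|x| &
    forall c, C c -> f z + r <= f c].
Proof.
move=> /convex_setP cC [c0 Cc0] r0 rC.
pose K : set (Y * R) := [set k | exists t c, [/\ 0 <= t, C c & k = (t *: (c - z), t * r)]].
have cK : convex_cone K.
  split.
  - by exists 0, c0; rewrite scale0r mul0r.
  - move=> _ _ [t [c [t0 Cc ->]]] [u [d [u0 Cd ->]]] /=.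
    have [->|t1] := eqVneq t 0.
      by exists u, d; rewrite scale0r mul0r !add0r.
    have tu : 0 < t + u by rewrite ltr_pwDl// lt_neqAle eq_sym t1.
    exists (t + u), (t / (t + u) *: c + (1 - t / (t + u)) *: d); split.
    + exact: ltW.
    + by apply: cC => //; rewrite divr_ge0 ?ler_pdivrMr ?mul1r ?lerDl// ltW.
    + congr (_, _); last by rewrite mulrDl.
      have tu0 : t + u != 0 by rewrite gt_eqF.
      have -> : 1 - t / (t + u) = u / (t + u) by field.
      rewrite !scalerBr scalerDr !scalerA ![(t + u) * (_ / _)]mulrC !divfK//.
      by rewrite scalerDl opprD addrACA.
  - move=> t _ t0 [u [d [u0 Cd ->]]] /=; exists (t * u), d.
    by rewrite scalerA mulrA mulr_ge0// ltW.
have nK k : K k -> k.2 <= `|k.1|.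
  move=> [t [c [t0 Cc ->]]] /=; rewrite normrZ ger0_norm// ler_wpM2l//.
  exact: rC.
have [h hl hp] := hahn_banach (conic_inf_sublinear norm_sublinear cK nK).
have h_le x : h x <= `|x|.
  by rewrite (le_trans (hp x))//; exact: (conic_inf_le_id norm_sublinear cK nK).
have h0 : h 0 = 0.
  have := hl 1 0 0; rewrite scaler0 addr0 mul1r => /eqP.
  by rewrite -subr_eq0 opprD addrA subrr sub0r oppr_eq0 => /eqP.
have hN x : h (- x) = - h x by have := hl (-1) x 0; rewrite !addr0 scaleN1r mulN1r h0 addr0.
have h_norm x : `|h x| <= `|x|.
  by rewrite ler_norml h_le andbT lerNl -hN (le_trans (h_le _))// normrN.
have fh : functional h by split=> //; exists 1 => x; rewrite mul1r.
exists h; split=> // c Cc.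
have Kc : K (c - z, r) by exists 1, c; rewrite scale1r mul1r.
have := le_trans (hp _) (conic_inf_cone norm_sublinear cK nK Kc) => /=.
rewrite functionalN// functionalB//; lra.
Qed.

(** Separate 0 from the point x. *)
Lemma norming (x : Y) : exists f : Y -> R,
  [/\ functional f, forall y, `|f y| <= `|y| & f x = `|x|].
Proof.
have c1 : convex_set [set x].
  by apply/convex_setP => _ _ t -> -> _ /=; rewrite -scalerDl addrC subrK scale1r.
have [|f [ff fn fx]] := separation c1 (ex_intro _ x erefl) (normr_ge0 x) (z := 0).
  by move=> _ ->; rewrite subr0.
exists f; split=> //; apply/eqP; rewrite eq_le (le_trans (ler_norm _) (fn _))/=.
by have := fx _ erefl; rewrite functional0// add0r.
Qed.

End Separation.

(** * The Daugavet property in terms of slices *)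

Section Daugavet.
Variables (R : realType) (Y : normedModType R).
Implicit Types (V : set Y) (f g : Y -> R) (x y z : Y).

(** The Daugavet property in terms of slices, relative to a subset: with z
    ranging over the unit ball of V, the condition f z - e <= f x says that
    x lies in a prescribed slice of that ball. *)
Definition daugavet_in V := forall f z y e, functional f -> V z -> `|z| <= 1 ->
  0 < e -> exists x, [/\ V x, `|x| <= 1, f z - e <= f x & `|y| + 1 - e <= `|y - x|].

(** Almost l1-orthogonality of u and v does not depend on the multiple of u:
    pass from a to b by subtracting or adding a multiple of u or of v. *)
Lemma norm_scale_sub (u v : Y) (a b d : R) : `|u| <= 1 -> `|v| <= 1 -> 0 < a ->
  0 <= b -> 0 <= d -> a + 1 - d <= `|a *: u - v| ->
  b + 1 - d * (1 + b / a) <= `|b *: u - v|.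
Proof.
move=> u1 v1 a0 b0 d0 h.
have [ba|/ltW ab] := leP b a.
  have -> : b *: u - v = (a *: u - v) + (b - a) *: u.
    by rewrite scalerBl [RHS]addrC addrA subrK.
  have := lerB_normD (a *: u - v) ((b - a) *: u).
  rewrite normrZ ler0_norm ?subr_le0//.
  have : 0 <= d * (b / a) by rewrite mulr_ge0// divr_ge0// ltW.
  move: u1 h; set nu := `|u|; set nw := `|_ - v|; nra.
have ba1 : 0 <= b / a - 1 by rewrite subr_ge0 ler_pdivlMr// mul1r.
have -> : b *: u - v = (b / a) *: (a *: u - v) + (b / a - 1) *: v.
  by rewrite scalerBl scalerBr scalerA divfK ?gt_eqF// scale1r addrA subrK.
have := lerB_normD ((b / a) *: (a *: u - v)) ((b / a - 1) *: v).
rewrite (normrZ (b / a)) (normrZ (b / a - 1)) (ger0_norm ba1) (ger0_norm (divr_ge0 b0 (ltW a0))).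
have : b / a * a = b by rewrite divfK ?gt_eqF.
move: v1 h ba1; set nv := `|v|; set nw := `|_ - v|; set c := b / a.
move=> v1 h c1 ca hb.
have h1 : 0 <= (c - 1) * (nw - (a + 1 - d)) by rewrite mulr_ge0// subr_ge0.
have h2 : 0 <= (c - 1) * (1 - nv) by rewrite mulr_ge0// subr_ge0.
nra.
Qed.

(** Apply the norm equality to the rank-one operator T x = - (f x / |y|) y,
    for which |T x| = |f x|.  A point x that almost attains |I + T| almost
    attains the norm of f, and it is almost orthogonal to y after a change
    of sign. *)
Lemma daugavet_setT_aux f z y e : Daugavet_property Y -> functional f ->
  (exists u, f u != 0) -> y != 0 -> `|z| <= 1 -> 0 < e ->
  exists x, [/\ `|x| <= 1, f z - e <= f x & `|y| + 1 - e <= `|y - x|].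
Proof.
move=> DY ff [u fu] y0 z1 e0.
have ny0 : 0 < `|y| by rewrite normr_gt0.
pose T0 x : Y := - (f x / `|y|) *: y.
have T0l : linear T0.
  move=> a v w; rewrite /T0 ff.1 scalerA -scalerDl; congr (_ *: _); ring.
pose T : {linear Y -> Y} := HB.pack T0 (GRing.isLinear.Build _ _ _ _ _ T0l).
have nT x : `|T x| = `|f x|.
  by rewrite /= /T0 normrZ normrN normrM normfV normr_id divfK ?gt_eqF.
have [_ [k fk]] := ff.
have k0 x : k * `|x| <= `|k| * `|x| by rewrite ler_wpM2r// ler_norm.
have Tb : bounded_fun_norm T.
  move=> r; exists (`|k| * r) => x xr; rewrite nT (le_trans (fk x))//.
  by rewrite (le_trans (k0 _))// ler_wpM2l.
have T1 : rank_one T.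
  exists y => //; apply/seteqP; split=> [_ [x _ <-]|_ [a _ <-]].
    by exists (- (f x / `|y|)).
  exists ((- a * `|y| / f u) *: u) => //=; rewrite /T0 (functionalZ _ _ ff); congr (_ *: _).
  by field; rewrite fu gt_eqF.
have /= := DY T Tb T1; set o := opnorm T => oE.
have So : has_sup [set `|T x| | x in [set x | `|x| <= 1]].
  split; first by exists `|T 0|, 0 => //=; rewrite normr0.
  exists `|k| => _ [x /= x1 <-]; rewrite nT (le_trans (fk x))//.
  by rewrite (le_trans (k0 _))// ler_piMr.
have leo x : `|x| <= 1 -> `|f x| <= o.
  by move=> x1; rewrite -nT; apply: ub_le_sup; [exact: So.2|exists x].
have o0 : 0 < o.
  have u0 : u != 0 by apply: contra_neq fu => ->; rewrite (functional0 ff).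
  have nu : 0 < `|u| by rewrite normr_gt0.
  apply: lt_le_trans (leo (`|u|^-1 *: u) _); last first.
    by rewrite normrZ normfV normr_id mulVf ?gt_eqF.
  by rewrite (functionalZ _ _ ff) normr_gt0 mulf_neq0// invr_eq0 gt_eqF.
have SIT : has_sup [set `|x + T x| | x in [set x | `|x| <= 1]].
  split; first by exists `|0 + T 0|, 0 => //=; rewrite normr0.
  exists (1 + o) => _ [x /= x1 <-]; rewrite (le_trans (ler_normD _ _))// lerD//.
  by rewrite nT leo.
(* The factor by which norm_scale_sub can enlarge the error d when the almost
   orthogonality is transferred from t *: w to y. *)
pose c := 1 + 2 * `|y| / o.
have c0 : 1 <= c by rewrite lerDl divr_ge0 ?(ltW o0)// mulr_ge0.
pose d := Num.min (o / 2) (e / c).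
have d0 : 0 < d by rewrite lt_min !divr_gt0// (lt_le_trans _ c0).
have dc : d * c <= e by rewrite -ler_pdivlMr ?ge_min ?lexx ?orbT// (lt_le_trans _ c0).
have d2 : d <= o / 2 by rewrite ge_min lexx.
have [_ [x /= x1 <-] xT] := sup_adherent d0 SIT.
rewrite -[sup _]/(opnorm _) oE in xT.
have [s s1 fs] : exists2 s : R, `|s| = 1 & s * f x = `|f x|.
  have [fx|fx] := lerP 0 (f x).
    by exists 1; rewrite ?normr1 ?mul1r ?ger0_norm.
  by exists (-1); rewrite ?normrN1 ?mulN1r ?ltr0_norm.
pose v := s *: x.
have v1 : `|v| <= 1 by rewrite normrZ s1 mul1r.
have fv : f v = `|f x| by rewrite functionalZ.
set t := `|f x| in fs fv.
have to : o - d < t.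
  have := ler_normD x (T x); rewrite nT -/t; lra.
have t0 : 0 < t by lra.
pose w := `|y|^-1 *: y.
have w1 : `|w| = 1 by rewrite normrZ normfV normr_id mulVf ?gt_eqF.
have yw : y = `|y| *: w by rewrite scalerA mulfV ?gt_eqF// scale1r.
have tw : t + 1 - d <= `|t *: w - v|.
  have -> : `|t *: w - v| = `|x + T x|.
    rewrite -[RHS]mul1r -s1 -normrZ distrC; congr (`|_|).
    rewrite scalerDr; congr (_ + _).
    by rewrite /T0 /w !scalerA -scaleNr -fs; congr (_ *: _); ring.
  have := leo _ x1; rewrite -/t; lra.
exists v; split=> //.
  have := leo _ z1; have := ler_norm (f z); rewrite fv.
  have : d <= e by rewrite (le_trans _ dc)// ler_pMr// .
  lra.
have wle1 : `|w| <= 1 by rewrite w1.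
have := norm_scale_sub wle1 v1 t0 (ltW ny0) (ltW d0) tw.
rewrite -yw; apply: le_trans; rewrite lerB// (le_trans _ dc)// ler_wpM2l ?(ltW d0)//.
rewrite lerD2l ler_pdivrMr// /c mulrAC ler_pdivlMr//.
have : 0 <= `|y| * (2 * t - o) by rewrite mulr_ge0//; lra.
move: ny0 {yw}; set n := `|y| => *; nra.
Qed.

(** The case f = 0 reduces to a norming functional, and the case y = 0 to
    any other y since then |x| is almost 1. *)
Lemma daugavet_setT : Daugavet_property Y -> (exists y : Y, y != 0) ->
  daugavet_in setT.
Proof.
move=> DY [y0 y00] f z y e ff _ z1 e0.
wlog fu : f z ff z1 / exists u, f u != 0.
  move=> wl; have [|f0] := pselect (exists u, f u != 0); first exact: wl.
  have {}f0 u : f u = 0.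
    by apply/eqP/negP => fu; apply: f0; exists u; apply/negP.
  have [g [gf _ gy]] := norming y0.
  have [||x [_ x1 _ xy]] := wl g 0 gf.
  - by rewrite normr0.
  - by exists y0; rewrite gy normr_eq0.
  by exists x; split=> //; rewrite !f0; lra.
have [->|yn0] := eqVneq y 0.
  have [x [x1 fx yx]] := daugavet_setT_aux DY ff fu y00 z1 e0.
  exists x; split=> //; rewrite sub0r normrN normr0 add0r.
  have := ler_normB y0 x; lra.
by have [x [x1 fx yx]] := daugavet_setT_aux DY ff fu yn0 z1 e0; exists x.
Qed.

End Daugavet.

(** * The Daugavet property on kernels *)

Section Kernel.
Variables (R : realType) (Y : normedModType R).
Implicit Types (V : set Y) (f g : Y -> R) (x y z : Y).

Definition linear_subspace V := V 0 /\ forall (a : R) x y, V x -> V y -> V (a *: x + y).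

Lemma small_half_pow (K e : R) : 0 < e -> exists n, K / 2 ^+ n <= e.
Proof.
move=> e0; exists (Num.bound `|K / e|).
rewrite ler_pdivrMr ?exprn_gt0// mulrC -ler_pdivrMr//.
rewrite (le_trans (ler_norm _))// (le_trans (ltW (archi_boundP _)))//.
by rewrite -natrX ler_nat ltnW// ltn_expl.
Qed.

Lemma functional_bound f : functional f -> exists2 k, 0 <= k &
  forall x, `|x| <= 1 -> `|f x| <= k.
Proof.
move=> [_ [k fk]]; exists `|k| => // x x1; rewrite (le_trans (fk x))//.
by rewrite (le_trans (ler_norm _))// normrM normr_id ler_piMr.
Qed.

Section Bisection.
Variables (V : set Y) (phi f : Y -> R) (y z : Y).
Hypotheses (V_sub : linear_subspace V) (DV : daugavet_in V).
Hypotheses (phi_fun : functional phi) (f_fun : functional f).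
Hypotheses (Vz : V z) (z1 : `|z| <= 1) (phiz : phi z = 0).
Hypothesis phiV : exists2 v, V v & phi v != 0.

(** Two points of the unit ball of V, on the two sides of the kernel of phi,
    both almost as large as z for the functional f + c phi (up to an error w
    in the multiplier c), and jointly almost orthogonal to y. *)
Definition straddle (w eta : R) := exists c a b,
  [/\ V a /\ V b, `|a| <= 1 /\ `|b| <= 1, phi a <= 0 <= phi b,
      f z - eta <= f a + c * phi a /\ f z - eta <= f b + (c + w) * phi b &
      `|y| + 2 - eta <= `|y - a - b|].

(** For c very negative a point at which f + c phi is large has phi <= 0,
    and symmetrically for c very positive. *)
Lemma straddle_wide : exists L, forall eta, 0 < eta <= 1 -> straddle L eta.
Proof.
have [v [Vv v1 phiv]] : exists v, [/\ V v, `|v| <= 1 & 0 < phi v].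
  have [u Vu u0] := phiV.
  have nu : 0 < `|u|.
    by rewrite normr_gt0; apply: contra_neq u0 => ->; rewrite (functional0 phi_fun).
  exists ((phi u / `|phi u| / `|u|) *: u); split.
  - by have := V_sub.2 (phi u / `|phi u| / `|u|) u 0 Vu V_sub.1; rewrite addr0.
  - by rewrite normrZ !normrM !normfV !normr_id divff ?normr_eq0// mul1r mulVf ?gt_eqF.
  - rewrite (functionalZ _ _ phi_fun).
    have -> : phi u / `|phi u| / `|u| * phi u = (phi u) ^+ 2 / (`|phi u| * `|u|).
      by field; rewrite gt_eqF// normr_eq0 u0.
    by rewrite divr_gt0// ?exprn_even_gt0// mulr_gt0// normr_gt0.
have [G G0 fG] := functional_bound f_fun.
(* With this M the term M * phi v outweighs all values of f on the ball, so a
   point that is almost as good as v lies on the same side as v. *)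
pose M := (2 * G + 2) / phi v.
have M0 : 0 < M by rewrite divr_gt0// ltr_wpDl// mulr_ge0.
have Mv : M * phi v = 2 * G + 2 by rewrite divfK ?gt_eqF.
have edge (s : R) y' eta : s * s = 1 -> `|s| = 1 -> 0 < eta <= 1 -> exists x,
    [/\ V x, `|x| <= 1, f z - eta <= f x + s * M * phi x, 0 <= s * phi x &
        `|y'| + 1 - eta <= `|y' - x|].
  move=> ss s1 /andP[eta0 eta1].
  have [||x [Vx x1 fx yx]] :=
      DV y' (functional_comb (s * M) f_fun phi_fun) (z := s *: v) _ _ eta0.
  - by have := V_sub.2 s v 0 Vv V_sub.1; rewrite addr0.
  - by rewrite normrZ s1 mul1r.
  have := fG _ x1; rewrite ler_norml => /andP[_ fx2].
  have := fG _ z1; rewrite ler_norml => /andP[_ fz2].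
  have := fG _ v1; rewrite ler_norml => /andP[fv1 fv2].
  rewrite (functionalZ _ _ phi_fun) (functionalZ _ _ f_fun) in fx.
  have sv : - G <= s * f v.
    have : `|s * f v| <= G by rewrite normrM s1 mul1r fG.
    by rewrite ler_norml => /andP[].
  have smv : s * M * (s * phi v) = 2 * G + 2 by rewrite -Mv mulrACA ss mul1r.
  exists x; split=> //; first lra.
  by rewrite -(pmulr_rge0 _ M0) mulrA [M * s]mulrC; lra.
exists (2 * M) => eta /andP[eta0 eta1].
have eta2 : 0 < eta / 2 <= 1 by lra.
have [||a [Va a1 fa phia ya]] := edge (-1) y _ _ _ eta2; rewrite ?normrN1//; first ring.
have [||b [Vb b1 fb phib yb]] := edge 1 (y - a) _ _ _ eta2; rewrite ?normr1//; first ring.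
by exists (- M), a, b; split=> //; [lra| |]; [split|]; lra.
Qed.

(** Bisection on c: a new point taken for the middle multiplier, almost
    orthogonal to y - a - b, replaces a or b according to the sign of phi.
    The orthogonality to y - a - b ensures that the remaining pair is still
    jointly orthogonal to y. *)
Lemma straddle_half w eta : 0 < eta -> straddle w (eta / 2) -> straddle (w / 2) eta.
Proof.
move=> eta0 [c [a [b [[Va Vb] [a1 b1] /andP[pa pb] [fa fb] yab]]]].
have eta2 : 0 < eta / 2 by lra.
have [x [Vx x1 fx yx]] := DV (y - a - b)
  (functional_comb (c + w / 2) f_fun phi_fun) Vz z1 eta2.
rewrite phiz mulr0 addr0 in fx.
have [px|/ltW px] := leP (phi x) 0.
  exists (c + w / 2), x, b; split=> //; first by rewrite px.
    split; first lra.
    have -> : c + w / 2 + w / 2 = c + w by field.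
    lra.
  have := ler_normB (y - x - b) a.
  have -> : y - x - b - a = y - a - b - x.
    by rewrite [LHS]addrAC [y - x - a]addrAC [LHS]addrAC.
  lra.
exists c, a, x; split=> //; first by rewrite pa.
  by split; lra.
have := ler_normB (y - a - x) b.
by rewrite [y - a - x - b]addrAC; lra.
Qed.

Lemma straddle_narrow e : 0 < e -> exists w eta,
  [/\ 0 <= w <= e, 0 < eta <= e & straddle w eta].
Proof.
move=> e0; have [L LP] := straddle_wide.
have P n eta : 0 < eta <= 1 -> straddle (`|L| / 2 ^+ n) eta.
  elim: n eta => [|n IH] eta /andP[eta0 eta1].
    have [|c [a [b [Vab ab1 pab [fa fb] yab]]]] := LP eta; first by rewrite eta0.
    exists c, a, b; split=> //; split=> //.
    rewrite expr0 divr1 (le_trans fb)// lerD2l ler_wpM2r//; last first.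
      by rewrite lerD2l ler_norm.
    by case/andP: pab.
  rewrite exprSr invfM mulrA; apply: straddle_half => //; apply: IH.
  by lra.
have [n nP] := small_half_pow `|L| e0.
exists (`|L| / 2 ^+ n), (Num.min 1 e); split.
- by rewrite nP divr_ge0// exprn_ge0.
- by rewrite lt_min ltr01 e0 ge_min lexx orbT.
- by apply: P; rewrite lt_min ltr01 e0 ge_min lexx.
Qed.

(** The segment between the two points of a narrow straddle meets the kernel
    of phi.  Joint orthogonality, |y - a - b| >= |y| + 2 - eta, is what
    makes every convex combination of a and b almost orthogonal to y. *)
Lemma daugavet_in_kernel_aux e : 0 < e -> exists x,
  [/\ V x, phi x = 0, `|x| <= 1, f z - e <= f x & `|y| + 1 - e <= `|y - x|].
Proof.
move=> e0; have [P P0 phiP] := functional_bound phi_fun.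
pose d := Num.min (e / 2) (e / 2 / (P + 1)).
have P1 : 0 < P + 1 by rewrite ltr_wpDl.
have d0 : 0 < d by rewrite lt_min !divr_gt0.
have dP : d * P <= e / 2.
  apply: (@le_trans _ _ (d * (P + 1))); first by rewrite ler_wpM2l ?lerDl// ltW.
  by rewrite -ler_pdivlMr// ge_min lexx orbT.
have d2 : d <= e / 2 by rewrite ge_min lexx.
have [w [eta [/andP[w0 wd] /andP[eta0 etad]]]] := straddle_narrow d0.
move=> [c [a [b [[Va Vb] [a1 b1] /andP[pa pb] [fa fb] yab]]]].
have [t [/andP[t0 t1] pt]] : exists t : R, 0 <= t <= 1 /\
    t * phi a + (1 - t) * phi b = 0.
  have [pab|pab] := eqVneq (phi b - phi a) 0.
    by exists 0; rewrite lexx ler01; split=> //; lra.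
  have pab0 : 0 < phi b - phi a by rewrite lt_neqAle eq_sym pab; lra.
  exists (phi b / (phi b - phi a)); split; last by field.
  by rewrite divr_ge0 ?(ltW pab0)//= ler_pdivrMr// mul1r; lra.
have t1' : 0 <= 1 - t by rewrite subr_ge0.
exists (t *: a + (1 - t) *: b); split.
- apply: V_sub.2 => //.
  by have := V_sub.2 (1 - t) b 0 Vb V_sub.1; rewrite addr0.
- by rewrite phi_fun.1 (functionalZ _ _ phi_fun).
- rewrite (le_trans (ler_normD _ _))// !normrZ (ger0_norm t0) (ger0_norm t1').
  move: a1 b1; set na := `|a|; set nb := `|b| => a1 b1; nra.
- rewrite f_fun.1 (functionalZ _ _ f_fun).
  have h1 : 0 <= t * (f a + c * phi a - (f z - eta)) by rewrite mulr_ge0// subr_ge0.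
  have h2 : 0 <= (1 - t) * (f b + (c + w) * phi b - (f z - eta)).
    by rewrite mulr_ge0// subr_ge0.
  have h3 : (1 - t) * phi b * w <= e / 2.
    rewrite (le_trans _ dP)// mulrC ler_pM// ?mulr_ge0//.
    rewrite (le_trans (ler_piMl _ _))//; first by rewrite gerBl.
    by rewrite (le_trans (ler_norm _))// phiP.
  have h4 : c * (t * phi a + (1 - t) * phi b) = 0 by rewrite pt mulr0.
  lra.
- have -> : y - (t *: a + (1 - t) *: b) = (y - a - b) + ((1 - t) *: a + t *: b).
    rewrite -[y - a - b]addrA -opprD -addrA; congr (_ + _).
    have {1}-> : a + b = t *: a + (1 - t) *: b + ((1 - t) *: a + t *: b).
      by rewrite addrACA -!scalerDl subrKC subrK !scale1r.
    by rewrite [X in _ = X + _]opprD addrNK.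
  have := lerB_normD (y - a - b) ((1 - t) *: a + t *: b).
  have := ler_normD ((1 - t) *: a) (t *: b).
  rewrite !normrZ (ger0_norm t0) (ger0_norm t1').
  move: a1 b1; set na := `|a|; set nb := `|b| => a1 b1; nra.
Qed.

End Bisection.

Lemma daugavet_in_kernel V phi : linear_subspace V -> functional phi -> daugavet_in V ->
  daugavet_in (V `&` [set x | phi x = 0]).
Proof.
move=> Vs fphi DV f z y e ff [Vz /= phiz] z1 e0.
have [phiV|phiV] := pselect (exists2 v, V v & phi v != 0).
  have [x [Vx phix x1 fx yx]] :=
    daugavet_in_kernel_aux y Vs DV fphi ff Vz z1 phiz phiV e0.
  by exists x.
have [x [Vx x1 fx yx]] := DV f z y e ff Vz z1 e0.
exists x; split=> //; split=> //=; apply/eqP/negP => phix; apply: phiV.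
by exists x => //; apply/negP.
Qed.

Lemma subspace_kernel V phi : linear_subspace V -> functional phi ->
  linear_subspace (V `&` [set x | phi x = 0]).
Proof.
move=> [V0 VD] fphi; split=> [|a x y [Vx /= px] [Vy /= py]].
  by split=> //=; exact: functional0.
by split; [exact: VD|rewrite /= fphi.1 px py mulr0 addr0].
Qed.

End Kernel.

(** * A countable set with the Daugavet property *)

Section Core.
Variables (R : realType) (Y : normedModType R).
Implicit Types (V W : set Y) (f g : Y -> R) (x y z : Y).

Lemma small_invS (e : R) : 0 < e -> exists n, n.+1%:R^-1 <= e.
Proof.
move=> e0; exists (Num.bound e^-1).
have ei : 0 < e^-1 by rewrite invr_gt0.
rewrite -[leRHS]invrK lef_pV2 ?posrE//.
by rewrite (le_trans (ltW (archi_boundP (ltW ei))))// ler_nat.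
Qed.

Lemma subspaceZ V (a : R) x : linear_subspace V -> V x -> V (a *: x).
Proof. by move=> [V0 VD] Vx; have := VD a x 0 Vx V0; rewrite addr0. Qed.

Lemma subspaceN V x : linear_subspace V -> V x -> V (- x).
Proof. by move=> sV Vx; rewrite -scaleN1r; exact: subspaceZ. Qed.

(** The point given by [daugavet_in] has norm almost 1, so it can be
    normalised. *)
Lemma daugavet_sphere W f z y e : linear_subspace W -> daugavet_in W ->
  functional f -> (forall x, `|f x| <= `|x|) -> W z -> `|z| <= 1 -> 0 < e ->
  exists x, [/\ W x, `|x| = 1, f z - e <= f x & `|y| + 1 - e <= `|y - x|].
Proof.
move=> sW DW ff fn Wz z1 e0.
pose d := Num.min 2^-1 (e / 2).
have d0 : 0 < d by rewrite lt_min invr_gt0 ltr0n divr_gt0.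
have [d1 d2] : d <= 2^-1 /\ d <= e / 2 by split; rewrite ge_min lexx ?orbT.
have [x [Wx x1 fx yx]] := DW f z y d ff Wz z1 d0.
have xd : 1 - d <= `|x|.
  by have := ler_normB y x; lra.
have x0 : 0 < `|x| by lra.
have xx : `|x - `|x|^-1 *: x| <= d.
  have -> : x - `|x|^-1 *: x = (1 - `|x|^-1) *: x by rewrite scalerBl scale1r.
  have -> : 1 - `|x|^-1 = - ((1 - `|x|) / `|x|) by field; rewrite gt_eqF.
  rewrite normrZ normrN normrM normfV normr_id divfK ?gt_eqF// ger0_norm; lra.
exists (`|x|^-1 *: x); split.
- exact: subspaceZ.
- by rewrite normrZ normfV normr_id mulVf ?gt_eqF.
- have := le_trans (ler_norm _) (fn (x - `|x|^-1 *: x)).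
  rewrite functionalB//; lra.
- have := ler_normB (y - `|x|^-1 *: x) (x - `|x|^-1 *: x).
  rewrite opprB addrA subrK; lra.
Qed.

(** The set of admissible x meets every slice of the ball that contains z,
    so no functional separates it from z.  In this form the property
    involves countably many data only. *)
Lemma daugavet_cch W z y e : linear_subspace W -> daugavet_in W ->
  W z -> `|z| <= 1 -> 0 < e ->
  closed_convex_hull [set x | [/\ W x, `|x| = 1 & `|y| + 1 - e <= `|y - x|]] z.
Proof.
move=> sW DW Wz z1 e0; set S := [set x | _].
have [//|/closureP nz] := pselect (closed_convex_hull S z).
have [r r0 rP] : exists2 r, 0 < r &
    forall c, smallest (@convex_set R Y) S c -> r <= `|c - z|.
  apply: contra_notP nz => nr r r0; apply: contra_notP nr => nc.
  exists r => // c Sc; rewrite leNgt distrC; apply/negP => zc; apply: nc.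
  by exists c.
have [|f [ff fn fc]] := separation (@convex_hull_convex _ _ S) _ (ltW r0) rP.
  have [|x [Wx x1 _ yx]] := daugavet_sphere y sW DW (@functional_zero R Y) _ Wz z1 e0.
    by move=> x; rewrite normr0.
  by exists x; apply: sub_gen_smallest.
pose d := Num.min e (r / 2).
have d0 : 0 < d by rewrite lt_min e0 divr_gt0.
have [de dr] : d <= e /\ d <= r / 2 by split; rewrite ge_min lexx ?orbT.
have [|x [Wx x1 fx yx]] :=
    daugavet_sphere y sW DW (functional_scale (-1) ff) _ Wz z1 d0.
  by move=> x; rewrite mulN1r normrN.
have /fc : smallest (@convex_set R Y) S x.
  apply: sub_gen_smallest; split=> //; lra.
lra.
Qed.

(** The points that have this property form a closed convex set. *)
Lemma cch_sequence (S : set Y) z : closed_convex_hull S z ->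
  exists2 g : nat -> Y, forall n, S (g n) & closed_convex_hull (range g) z.
Proof.
pose E := [set x | exists2 g : nat -> Y, forall n, S (g n) &
  closed_convex_hull (range g) x].
suff : closed_convex_hull S `<=` E by exact.
apply: cch_sub => [||x Sx].
- apply/convex_setP => x y t [g Sg gx] [h Sh hy] t01.
  exists (fun n => if odd n then g n./2 else h n./2).
    by move=> n; case: ifP.
  apply: (convex_setP _).1 => //; first exact: cch_convex.
    apply: cch_mono gx => _ [n _ <-]; exists n.*2.+1 => //=.
    by rewrite odd_double/= uphalf_double.
  apply: cch_mono hy => _ [n _ <-]; exists n.*2 => //=.
  by rewrite odd_double doubleK.
- apply: closedP => x /closureP Ex.
  have /choice[xg xgP] : forall n : nat, exists p : Y * (nat -> Y),
      [/\ `|x - p.1| < n.+1%:R^-1, forall k, S (p.2 k) &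
          closed_convex_hull (range p.2) p.1].
    move=> n; have [a [g Sg ga] xa] := Ex n.+1%:R^-1 ltac:(by rewrite invr_gt0).
    by exists (a, g).
  exists (fun n => if unpickle n is Some (k, j) then (xg k).2 j else (xg 0).2 0).
    move=> n; case: (unpickle n) => [[k j]|].
      by have [_ h _] := xgP k; exact: h.
    by have [_ h _] := xgP 0%N; exact: h.
  apply: cch_closed; apply/closureP => e e0.
  have [n ne] := small_invS e0.
  have [xa _ ga] := xgP n; exists (xg n).1; last exact: lt_le_trans ne.
  apply: cch_mono ga => _ [k _ <-]; exists (pickle (n, k)) => //.
  by rewrite pickleK.
- exists (fun=> x) => //; apply: sub_cch; by exists 0.
Qed.

(** The values of op on finite trees are countably many and closed under op;
    trees form a countable type. *)
Lemma countable_closure (T : Type) (op : nat -> seq T -> T) :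
  exists u : nat -> T, (forall n, exists k l, u n = op k l) /\
    forall k l, exists n, u n = op k (map u l).
Proof.
pose fix eval (t : GenTree.tree nat) : T :=
  match t with
  | GenTree.Leaf n => op n [::]
  | GenTree.Node n l => op n (map eval l)
  end.
pose u n := if unpickle n is Some t then eval t else op 0 [::].
exists u; split=> [n|k l].
  rewrite /u; case: (unpickle n) => [[k|k l]|]; last by exists 0, [::].
    by exists k, [::].
  by exists k, (map eval l).
pose tr n : GenTree.tree nat := if unpickle n is Some t then t else GenTree.Leaf 0.
exists (pickle (GenTree.Node k (map tr l))); rewrite /u pickleK /= -map_comp.
congr op; apply: eq_map => n /=; rewrite /tr.
by case: (unpickle n).
Qed.

(** A symmetric sequence in the unit sphere whose closed convex hull
    inherits the Daugavet property as far as finite sums of its terms are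
    concerned. *)
Definition daugavet_sequence (u : nat -> Y) :=
  [/\ forall n, `|u n| = 1, forall n, exists m, u m = - u n &
   forall f n (l : seq nat) e, functional f -> 0 < e ->
     exists m, f (u n) - e <= f (u m) /\
       `|\sum_(i <- l) u i| + 1 - e <= `|\sum_(i <- l) u i - u m|].

(** Close the points d n under negation and under the countable witnesses
    that [cch_sequence] extracts from [daugavet_cch], for all finite sums y,
    all z and all e = 1 / (k + 1). *)
Lemma exists_daugavet_sequence W (d : nat -> Y) : linear_subspace W -> daugavet_in W ->
  (forall n, W (d n) /\ `|d n| = 1) ->
  exists u, [/\ daugavet_sequence u, forall n, W (u n) & forall n, exists m, u m = d n].
Proof.
move=> sW DW dW.
have /choice[w wP] : forall p : Y * Y * nat, exists g : nat -> Y,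
    W p.1.1 -> `|p.1.1| = 1 ->
    (forall j, [/\ W (g j), `|g j| = 1 &
      `|p.1.2| + 1 - p.2.+1%:R^-1 <= `|p.1.2 - g j|]) /\
    closed_convex_hull (range g) p.1.1.
  move=> [[z y] k] /=.
  have [[Wz z1]|nz] := pselect (W z /\ `|z| = 1); last first.
    by exists (fun=> 0) => Wz z1; case: nz.
  have [||g gS gz] :=
    cch_sequence (daugavet_cch (z := z) y (e := k.+1%:R^-1) sW DW Wz _ _).
  - by rewrite z1.
  - by rewrite invr_gt0.
  by exists g.
(* Whatever the arguments of op are, clip makes its value a unit vector of W,
   so u stays in the unit sphere of W. *)
pose clip z := if `[< W z /\ `|z| = 1 >] then z else d 0%N.
have clipP z : W (clip z) /\ `|clip z| = 1.
  by rewrite /clip; case: asboolP.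
have clip_id z : W z -> `|z| = 1 -> clip z = z.
  by rewrite /clip; case: asboolP => // nz ? ?; case: nz.
pose op (k : nat) (l : seq Y) := clip
  match unpickle k : option (nat + (unit + nat * nat)) with
  | Some (inl n) => d n
  | Some (inr (inl _)) => - head 0 l
  | Some (inr (inr (k, j))) => w (head 0 l, \sum_(x <- behead l) x, k) j
  | None => 0
  end.
have [u [uop opu]] := countable_closure op.
have uP n : W (u n) /\ `|u n| = 1.
  by have [k [l ->]] := uop n; exact: clipP.
exists u; split=> [|n|n]; last 2 first.
- by have [] := uP n.
- have [m um] := opu (pickle (inl n : nat + (unit + nat * nat))) [::].
  by exists m; rewrite um /op pickleK; have [? ?] := dW n; rewrite clip_id.
split=> [n|n|f n l e ff e0]; first by have [] := uP n.
- have [m um] := opu (pickle (inr (inl tt) : nat + (unit + nat * nat))) [:: n].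
  have [Wn n1] := uP n; exists m; rewrite um /op pickleK /= clip_id ?normrN//.
  exact: subspaceN.
have [k ke] := small_invS e0.
have [Wn n1] := uP n.
set y := \sum_(i <- l) u i.
have [gP gn] := wP (u n, y, k) Wn n1.
have [j fj] : exists j, f (u n) - e <= f (w (u n, y, k) j).
  apply: contrapT => nj.
  have : f (u n) <= f (u n) - e; last by lra.
  apply: (cch_halfspace ff _ gn) => _ [j _ <-]; rewrite leNgt; apply/negP.
  by move=> /ltW fj; apply: nj; exists j.
have [m um] := opu (pickle (inr (inr (k, j)) : nat + (unit + nat * nat))) (n :: l).
exists m; have [Wj j1 yj] := gP j.
rewrite um /op pickleK /= big_map clip_id//; split=> //.
by apply: le_trans yj; rewrite lerD2l lerN2.
Qed.

End Core.

(** * A criterion for slicely countably determined sets *)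

Section SCDCriterion.
Variables (R : realType) (Y : normedModType R).

Lemma bounded_setP (A : set Y) : bounded_set A <-> exists M, forall x, A x -> `|x| <= M.
Proof.
split=> [[M [_ MP]]|[M MP]]; first by exists (M + 1); apply: MP; rewrite ltrDl.
by exists M; split; [exact: num_real|move=> r /ltW Mr x /MP /le_trans; apply].
Qed.

Lemma cch_bounded (A : set Y) M : (forall x, A x -> `|x| <= M) ->
  forall x, closed_convex_hull A x -> `|x| <= M.
Proof.
move=> AM; suff : closed_convex_hull A `<=` [set x | `|x| <= M] by exact.
apply: cch_sub => //.
- apply/convex_setP => x y t /= xM yM /andP[t0 t1].
  rewrite (le_trans (ler_normD _ _))// !normrZ (ger0_norm t0) ger0_norm ?subr_ge0//.
  move: xM yM; set a := `|x|; set b := `|y| => xM yM; nra.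
- apply: (@closed_sublevel _ _ _ 1) => x y.
  by rewrite mul1r lerB_dist.
Qed.

(** If the estimate holds at all p j, it holds on the closed convex hull,
    since the inequality defines a closed convex set.  So f attains its
    supremum at p n, and the slices defined by f shrink to p n. *)
Lemma SCD_exposed (p : nat -> Y) :
  (exists M, forall n, `|p n| <= M) ->
  (forall n, exists f k, [/\ functional f, exists y, f y != 0, 0 < k &
     forall j, `|p j - p n| <= k * (f (p n) - f (p j))]) ->
  SCD (closed_convex_hull (range p)).
Proof.
move=> [M pM] exp; set A := closed_convex_hull _.
have AM x : A x -> `|x| <= M by apply: cch_bounded => _ [n _ <-].
have Ap n : A (p n) by apply: sub_cch; exists n.
split; first by apply/bounded_setP; exists M.
have /choice[fk fkP] : forall n, exists fk : (Y -> R) * R,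
    [/\ functional fk.1, exists y, fk.1 y != 0, 0 < fk.2 &
     forall x, A x -> `|x - p n| <= fk.2 * (fk.1 (p n) - fk.1 x)].
  move=> n; have [f [k [ff f0 k0 pn]]] := exp n; exists (f, k); split=> //=.
  suff : A `<=` [set x | `|x - p n| + k * f x <= k * f (p n)].
    by move=> h x /h /=; rewrite mulrBr; lra.
  have [_ [l fl]] := ff.
  apply: cch_sub => [||_ [j _ <-] /=]; last by have := pn j; rewrite mulrBr; lra.
    apply/convex_setP => x y t /= hx hy /andP[t0 t1].
    rewrite ff.1 (functionalZ _ _ ff).
    have -> : t *: x + (1 - t) *: y - p n = t *: (x - p n) + (1 - t) *: (y - p n).
      rewrite !scalerBr addrACA -opprD -[t *: p n + _]scalerDl.
      by rewrite subrKC scale1r.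
    have := ler_normD (t *: (x - p n)) ((1 - t) *: (y - p n)).
    rewrite !normrZ (ger0_norm t0) (@ger0_norm _ (1 - t)) ?subr_ge0//.
    move: hx hy; set a := `|x - _|; set b := `|y - _|; nra.
  apply: (@closed_sublevel _ _ _ (1 + k * l)) => x y.
  have h1 : `|x - p n| - `|y - p n| <= `|x - y|.
    have := lerB_dist (x - p n) (y - p n).
    by rewrite opprB addrA subrK.
  have h2 : f x - f y <= l * `|x - y|.
    by rewrite -functionalB// (le_trans (ler_norm _)).
  have := ler_wpM2l (ltW k0) h2; lra.
pose U (n m : nat) := slice A (fk n).1 (m.+1%:R^-1 / (fk n).2).
have supE n : sup ((fk n).1 @` A) = (fk n).1 (p n).
  have [ff _ k0 fP] := fkP n.
  have le x : A x -> (fk n).1 x <= (fk n).1 (p n).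
    by move=> /fP h; rewrite -subr_ge0 -(pmulr_rge0 _ k0) (le_trans _ h).
  have hb : has_ubound ((fk n).1 @` A).
    by exists ((fk n).1 (p n)) => _ [x Ax <-]; exact: le.
  apply/eqP; rewrite eq_le; apply/andP; split.
    by apply: ge_sup; [exists ((fk n).1 (p n)), (p n)|move=> _ [x Ax <-]; exact: le].
  by apply: ub_le_sup => //; exists (p n).
have Upn n m : U n m (p n).
  have [ff _ k0 fP] := fkP n.
  by split=> //; rewrite supE ltrBlDr ltrDl divr_gt0// invr_gt0.
have Usmall n m x : U n m x -> `|x - p n| < m.+1%:R^-1.
  have [ff _ k0 fP] := fkP n.
  move=> [Ax]; rewrite supE => fx; apply: le_lt_trans (fP _ Ax) _.
  by rewrite mulrC -ltr_pdivlMr// ltrBlDr addrC -ltrBlDr.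
pose V k := let nm := odflt (0%N, 0%N) (unpickle k) in U nm.1 nm.2.
exists V; split=> [k|]; [|split=> [k|B BV]].
- have [ff f0 k0 _] := fkP (odflt (0%N, 0%N) (unpickle k)).1.
  have [h hc hE] := functional_linear ff.
  have hfk : (h : Y -> R) = (fk (odflt (0%N, 0%N) (unpickle k)).1).1.
    exact/funext.
  exists h, ((odflt (0%N, 0%N) (unpickle k)).2.+1%:R^-1 /
             (fk (odflt (0%N, 0%N) (unpickle k)).1).2); split=> //.
  + by have [y fy] := f0; exists y; rewrite hE.
  + by rewrite divr_gt0// invr_gt0.
  + by rewrite /V /U hfk.
- by split; [exists (p (odflt (0%N, 0%N) (unpickle k)).1); exact: Upn|move=> x []].
- apply: cch_sub => [||_ [n _ <-]]; [exact: cch_convex|exact: cch_closed|].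
  have : closure B (p n).
    apply/closureP => e e0; have [m me] := small_invS e0.
    have [x [Bx]] := BV (pickle (n, m)); rewrite /V pickleK /= => /Usmall xm.
    by exists x => //; rewrite distrC (lt_le_trans xm).
  by apply: closure_subset; exact: sub_gen_smallest.
Qed.

End SCDCriterion.

(** * The two summands *)

Section Summand.
Variables (R : realType) (Y : normedModType R).
Variables (u : nat -> Y) (e1 e2 : Y) (phi1 phi2 : Y -> R).
Hypothesis u_core : daugavet_sequence u.
Hypotheses (phi1_fun : functional phi1) (phi2_fun : functional phi2).
Hypotheses (phi1u : forall n, phi1 (u n) = 0) (phi2u : forall n, phi2 (u n) = 0).
Hypotheses (phi1e1 : phi1 e1 = 1) (phi1e2 : phi1 e2 = 0).
Hypotheses (phi2e1 : phi2 e1 = 0) (phi2e2 : phi2 e2 = 1).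

Definition scale (n : nat) : R := 2^-1 ^+ n.

(** The index logn 2 n takes every natural number infinitely often.  The
    coefficient 1 - scale n ^+ 2 puts the points (scale n, norm of the first
    term) on a strictly concave curve, which makes each vertex exposed. *)
Definition vertex (n : nat) : Y :=
  (1 - scale n ^+ 2) *: u (logn 2 n) + ((1 - scale n) *: e1 + scale n *: e2).

(** Both signs of each vertex in one sequence: even indices give vertex n,
    odd indices its opposite. *)
Definition signed_vertex (n : nat) : Y := (-1) ^+ odd n *: vertex n./2.

Definition summand : set Y := closed_convex_hull (range signed_vertex).

Let u1 n : `|u n| = 1. Proof. by case: u_core. Qed.

Lemma scale_gt0 n : 0 < scale n.
Proof. by rewrite exprn_gt0// invr_gt0. Qed.

Lemma scale_le1 n : scale n <= 1.
Proof. by rewrite exprn_ile1// invf_le1// ler1n. Qed.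

Lemma scale_half i j : (i < j)%N -> scale j <= scale i / 2.
Proof.
move=> ij; rewrite -exprSr; apply: ler_wiXn2l => //.
by rewrite invf_le1// ler1n.
Qed.

Lemma scale_sep n i : i != n -> scale n ^+ 2 / 4 <= (scale i - scale n) ^+ 2.
Proof.
rewrite neq_ltn; have := scale_gt0 n; have := scale_gt0 i => si sn.
by move=> /orP[/scale_half|/scale_half] h; nra.
Qed.

Lemma signed_vertex_sym n : exists m, signed_vertex m = - signed_vertex n.
Proof.
rewrite /signed_vertex; have [on|en] := boolP (odd n).
  by exists (n./2.*2); rewrite odd_double doubleK expr0 scale1r expr1 scaleN1r opprK.
exists (n./2.*2.+1); rewrite /= odd_double/= uphalf_double.
by rewrite expr0 expr1 scaleN1r scale1r.
Qed.

Lemma vertex_norm n : `|vertex n| <= 1 + `|e1| + `|e2|.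
Proof.
have s0 := ltW (scale_gt0 n); have s1 := scale_le1 n.
rewrite -addrA (le_trans (ler_normD _ _))// lerD//.
  rewrite normrZ u1 mulr1 ger0_norm ?gerBl ?sqr_ge0// subr_ge0.
  by rewrite exprn_ile1.
rewrite (le_trans (ler_normD _ _))// lerD// normrZ ler_piMl//.
  by rewrite ger0_norm ?subr_ge0// gerBl.
by rewrite ger0_norm.
Qed.

Lemma signed_vertex_norm n : `|signed_vertex n| <= 1 + `|e1| + `|e2|.
Proof. by rewrite normrZ normrX normrN1 expr1n mul1r vertex_norm. Qed.

Lemma functional_vertex f n : functional f -> f (vertex n) =
  (1 - scale n ^+ 2) * f (u (logn 2 n)) + (1 - scale n) * f e1 + scale n * f e2.
Proof. by move=> ff; rewrite ff.1 ff.1 (functionalZ _ _ ff) addrA. Qed.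

(** The functional f norms the direction u (logn 2 n), and f e1 = 0, f e2 =
    2 scale n.  Hence f (vertex i) is at most f (vertex n) - (scale i -
    scale n) ^+ 2, by completing a square. *)
Lemma vertex_exposed n : exists f d, [/\ functional f, f (u (logn 2 n)) != 0, 0 < d &
  (forall i, i != n -> f (vertex i) + d <= f (vertex n)) /\
  (forall i, - f (vertex i) + d <= f (vertex n))].
Proof.
have [g [gf gn gu]] := norming (u (logn 2 n)); rewrite u1 in gu.
(* The two corrections vanish at every u i, and they set f e1 = 0 and f e2 = 2
   scale n. *)
pose f x := g x + (- g e1) * phi1 x + (2 * scale n - g e2) * phi2 x.
have ff : functional f by do 2 apply: functional_comb => //.
have fu i : f (u i) = g (u i) by rewrite /f phi1u phi2u !mulr0 !addr0.
have fe1 : f e1 = 0 by rewrite /f phi1e1 phi2e1; ring.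
have fe2 : f e2 = 2 * scale n by rewrite /f phi1e2 phi2e2; ring.
have gu1 i : - 1 <= g (u i) <= 1 by rewrite -ler_norml -(u1 i) gn.
exists f, (scale n ^+ 2 / 4); split=> //.
- by rewrite fu gu oner_eq0.
- by rewrite divr_gt0// exprn_gt0// scale_gt0.
have sn := scale_gt0 n.
have bnd i : (1 - scale i ^+ 2) * g (u (logn 2 i)) <= 1 - scale i ^+ 2 /\
             - ((1 - scale i ^+ 2) * g (u (logn 2 i))) <= 1 - scale i ^+ 2.
  have /andP[h1 h2] := gu1 (logn 2 i).
  have s1 : 0 <= 1 - scale i ^+ 2 by rewrite subr_ge0 exprn_ile1 ?(ltW (scale_gt0 i))// scale_le1.
  by split; nra.
split=> [i ni|i]; rewrite !functional_vertex// !fu fe1 fe2 gu.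
  have [h _] := bnd i; have := scale_sep ni; lra.
have [_ h] := bnd i; have := scale_gt0 i; nra.
Qed.

Lemma summand_SCD : SCD summand.
Proof.
apply: SCD_exposed; first by exists (1 + `|e1| + `|e2|); exact: signed_vertex_norm.
move=> m; have [f [d [ff fu d0 [fv fNv]]]] := vertex_exposed m./2.
pose M := 1 + `|e1| + `|e2|.
have M0 : 0 < M by rewrite /M; have := normr_ge0 e1; have := normr_ge0 e2; lra.
pose s : R := (-1) ^+ odd m.
have ss : s * s = 1 by rewrite -expr2 sqrr_sign.
exists (fun x => s * f x), (2 * M / d); split.
- exact: functional_scale.
- exists (u (logn 2 m./2)); rewrite mulf_neq0// signr_eq0//.
- by rewrite divr_gt0// mulr_gt0.
move=> j; rewrite [X in s * X](functionalZ _ _ ff) -/s mulrA ss mul1r.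
rewrite (functionalZ _ _ ff) mulrA.
have far x : d <= x -> `|signed_vertex j - signed_vertex m| <= 2 * M / d * x.
  move=> dx; have := ler_normB (signed_vertex j) (signed_vertex m).
  have := signed_vertex_norm j; have := signed_vertex_norm m; rewrite -/M => h1 h2 h3.
  have : 2 * M <= 2 * M / d * x.
    by rewrite mulrAC ler_pdivlMr// ler_wpM2l// mulr_ge0// ltW.
  lra.
have [t1|t1] : s * (-1) ^+ odd j = 1 \/ s * (-1) ^+ odd j = -1.
- by rewrite /s -signr_addb; case: (_ (+) _); [right|left]; rewrite ?expr0 ?expr1.
- rewrite t1 mul1r; have [jm|jm] := eqVneq j./2 m./2.
    rewrite jm subrr mulr0 /signed_vertex jm -scalerBl.
    have -> : (-1) ^+ odd j = s by move: (congr1 ( *%R s) t1); rewrite mulrA ss mul1r mulr1.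
    by rewrite subrr scale0r normr0.
  by apply: far; have := fv _ jm; lra.
- by rewrite t1 mulN1r opprK; apply: far; have := fNv j./2; lra.
Qed.

Lemma summand_sym x : summand x -> summand (- x).
Proof.
suff : summand `<=` [set x | summand (- x)] by exact.
have /convex_setP cS := @cch_convex _ _ (range signed_vertex).
apply: cch_sub => [||_ [n _ <-] /=].
- apply/convex_setP => a b t /= ha hb t01.
  by rewrite opprD -!scalerN; exact: cS.
- apply: closedP => a /closureP ha /=; apply: cch_closed; apply/closureP => e e0.
  have [b /= hb ab] := ha _ e0; exists (- b) => //.
  by rewrite -opprD normrN.
- by have [m <-] := signed_vertex_sym n; apply: sub_cch; exists m.
Qed.

Lemma summand_ccbs : convex_closed_bounded_symmetric summand.
Proof.
split; [exact: cch_convex|exact: cch_closed| |].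
  apply/bounded_setP; exists (1 + `|e1| + `|e2|); apply: cch_bounded => _ [n _ <-].
  exact: signed_vertex_norm.
apply/seteqP; split=> [_ [x Cx <-]|x Cx]; first exact: summand_sym.
by exists (- x); [exact: summand_sym|rewrite opprK].
Qed.

Lemma summand_vertex n : summand (vertex n).
Proof.
apply: sub_cch; exists n.*2 => //.
by rewrite /signed_vertex odd_double doubleK expr0 scale1r.
Qed.

(** Along the indices n with logn 2 n = k the vertices converge to u k + e1. *)
Lemma summand_face k : summand (u k + e1) /\ summand (u k - e1).
Proof.
have face m : summand (u m + e1).
  apply: cch_closed; apply/closureP => e e0.
  pose M := 1 + `|e1| + `|e2|.
  have M0 : 0 < M by rewrite /M; have := normr_ge0 e1; have := normr_ge0 e2; lra.
  have [N hN] := small_half_pow M (divr_gt0 e0 (ltr0n _ 2)).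
  pose n := (2 ^ m * (N.*2.+1))%N.
  have logn_n : logn 2 n = m.
    rewrite /n lognM ?expn_gt0// pfactorK// lognE/= dvdn2/= odd_double/=.
    by rewrite addn0.
  exists (vertex n); first exact: summand_vertex.
  have sn : scale n * M <= e / 2.
    rewrite (le_trans _ hN)// mulrC ler_wpM2l ?(ltW M0)// -exprVn.
    apply: ler_wiXn2l => //; first by rewrite invf_le1// ler1n.
    apply: (@leq_trans N.*2.+1); first by rewrite -addnn leqW// leq_addr.
    by rewrite leq_pmull// expn_gt0.
  rewrite /vertex logn_n.
  have -> : u m + e1 - ((1 - scale n ^+ 2) *: u m + ((1 - scale n) *: e1 + scale n *: e2)) =
      scale n *: (scale n *: u m + (e1 - e2)).
    rewrite !scalerDr scalerN scalerA -expr2 !scalerBl !scale1r opprD addrACA.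
    by rewrite subKr; congr (_ + _); rewrite opprD addrA subKr.
  rewrite normrZ (ger0_norm (ltW (scale_gt0 n))).
  apply: (@le_lt_trans _ _ (scale n * M)); last by lra.
  rewrite ler_wpM2l ?(ltW (scale_gt0 n))// /M -addrA (le_trans (ler_normD _ _))// lerD//.
    by rewrite normrZ u1 mulr1 ger0_norm ?scale_le1// ltW// scale_gt0.
  exact: ler_normB.
split=> //; have [_ uN _] := u_core; have [m mk] := uN k.
by rewrite -[u k - e1]opprK; apply: summand_sym; rewrite opprB addrC -mk.
Qed.

(** On vertices the e-part of f is a convex combination of f e1 and f e2, so
    under this hypothesis f cannot be larger on a vertex than on the faces
    that contain the u k + e1 and the u k - e1. *)
Lemma summand_slice f : functional f -> `|f e2| <= `|f e1| ->
  exists s : R, (s = 1 \/ s = -1) /\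
  forall c e, summand c -> 0 < e -> exists k, f c - e <= f (u k) + s * f e1.
Proof.
move=> ff f21.
have [s s1 sf] : exists2 s : R, (s = 1 \/ s = -1) & s * f e1 = `|f e1|.
  have [fx|fx] := lerP 0 (f e1).
    by exists 1; [left|rewrite mul1r ger0_norm].
  by exists (-1); [right|rewrite mulN1r ltr0_norm].
exists s; split=> // c e Cc e0; rewrite sf; apply: contrapT => nk.
have ub k : f (u k) + `|f e1| <= f c - e.
  by rewrite leNgt; apply/negP => /ltW h; apply: nk; exists k.
have ubN k : - f (u k) + `|f e1| <= f c - e.
  have [_ uN _] := u_core; have [m mk] := uN k.
  by rewrite -functionalN// -mk.
have vub n : `|f (vertex n)| <= f c - e.
  have sn0 := scale_gt0 n; have sn1 := scale_le1 n.
  have fe : `|(1 - scale n) * f e1 + scale n * f e2| <= `|f e1|.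
    rewrite (le_trans (ler_normD _ _))// !normrM (ger0_norm (ltW sn0)).
    have -> : `|1 - scale n| = 1 - scale n by rewrite ger0_norm ?subr_ge0.
    move: f21; set a := `|f e1|; set b := `|f e2| => ba; nra.
  rewrite functional_vertex// -addrA (le_trans (ler_normD _ _))//.
  have : `|(1 - scale n ^+ 2) * f (u (logn 2 n))| <= `|f (u (logn 2 n))|.
    rewrite normrM ler_piMl// ger0_norm ?gerBl ?sqr_ge0// subr_ge0.
    by rewrite exprn_ile1// ltW.
  have : `|f (u (logn 2 n))| <= f c - e - `|f e1|.
    by rewrite ler_norml; have := ub (logn 2 n); have := ubN (logn 2 n); lra.
  lra.
have : f c <= f c - e; last by lra.
apply: (cch_halfspace ff _ Cc) => _ [n _ <-].
rewrite (le_trans _ (vub n./2))// (le_trans (ler_norm _))//.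
by rewrite (functionalZ _ _ ff) normrM normrX normrN1 expr1n mul1r.
Qed.

End Summand.

(** * The Minkowski sum *)

Section Sum.
Variables (R : realType) (Y : normedModType R).
Variables (u : nat -> Y) (e1 e2 : Y) (phi1 phi2 : Y -> R).
Hypothesis u_core : daugavet_sequence u.
Hypotheses (phi1_fun : functional phi1) (phi2_fun : functional phi2).
Hypotheses (phi1u : forall n, phi1 (u n) = 0) (phi2u : forall n, phi2 (u n) = 0).
Hypotheses (phi1e1 : phi1 e1 = 1) (phi1e2 : phi1 e2 = 0).
Hypotheses (phi2e1 : phi2 e1 = 0) (phi2e2 : phi2 e2 = 1).

(** The projection onto the common kernel of phi1 and phi2 along e1 and e2. *)
Definition kerproj (x : Y) : Y := x - (phi1 x *: e1 + phi2 x *: e2).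

Lemma proj_linear (a : R) x y : kerproj (a *: x + y) = a *: kerproj x + kerproj y.
Proof.
rewrite /kerproj phi1_fun.1 phi2_fun.1 !scalerDl -!scalerA.
by rewrite scalerBr scalerDr addrACA opprD addrACA.
Qed.

Lemma projZ (a : R) x : kerproj (a *: x) = a *: kerproj x.
Proof.
have p0 : kerproj 0 = 0.
  by rewrite /kerproj !functional0// !scale0r addr0 subr0.
by rewrite -[a *: x]addr0 proj_linear p0 addr0.
Qed.

Lemma projD x y : kerproj (x + y) = kerproj x + kerproj y.
Proof. by rewrite -[x]scale1r proj_linear !scale1r. Qed.

Lemma projB x y : kerproj (x - y) = kerproj x - kerproj y.
Proof. by rewrite projD -scaleN1r projZ scaleN1r. Qed.

Lemma proj_kernel x : phi1 (kerproj x) = 0 /\ phi2 (kerproj x) = 0.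
Proof.
split; rewrite /kerproj.
  rewrite (functionalB _ _ phi1_fun) phi1_fun.1 (functionalZ _ _ phi1_fun).
  by rewrite phi1e1 phi1e2 mulr0 mulr1 addr0 subrr.
rewrite (functionalB _ _ phi2_fun) phi2_fun.1 (functionalZ _ _ phi2_fun).
by rewrite phi2e1 phi2e2 mulr0 mulr1 add0r subrr.
Qed.

Lemma proj_e1 : kerproj e1 = 0.
Proof. by rewrite /kerproj phi1e1 phi2e1 scale1r scale0r addr0 subrr. Qed.

Lemma proj_e2 : kerproj e2 = 0.
Proof. by rewrite /kerproj phi1e2 phi2e2 scale1r scale0r add0r subrr. Qed.

Lemma proj_u n : kerproj (u n) = u n.
Proof. by rewrite /kerproj phi1u phi2u !scale0r addr0 subr0. Qed.

Lemma proj_bounded : exists2 k, 0 < k & forall x, `|kerproj x| <= k * `|x|.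
Proof.
have [_ [k1 k1P]] := phi1_fun; have [_ [k2 k2P]] := phi2_fun.
exists (1 + `|k1| * `|e1| + `|k2| * `|e2|).
  by rewrite -addrA ltr_pwDl// addr_ge0// mulr_ge0.
move=> x; rewrite (le_trans (ler_normB _ _))// mulrDl mulrDl mul1r -addrA lerD//.
rewrite (le_trans (ler_normD _ _))// lerD// normrZ mulrAC ler_wpM2r//.
  by rewrite (le_trans (k1P x))// ler_wpM2r// ler_norm.
by rewrite (le_trans (k2P x))// ler_wpM2r// ler_norm.
Qed.

Lemma closed_proj_sublevel (c : Y) (m : R) : closed [set x | `|kerproj x - c| <= m].
Proof.
have [k k0 kP] := proj_bounded.
apply: (@closed_sublevel _ _ _ k) => x y.
by rewrite (le_trans (lerB_dist _ _))// opprB addrA subrK -projB.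
Qed.

Lemma summand_proj x : summand u e1 e2 x \/ summand u e2 e1 x -> `|kerproj x| <= 1.
Proof.
have vert a b : kerproj a = 0 -> kerproj b = 0 ->
    summand u a b `<=` [set x | `|kerproj x - 0| <= 1].
  move=> pa pb; apply: cch_sub => [||_ [n _ <-] /=].
  - apply/convex_setP => y z t /=; rewrite !subr0 => y1 z1 /andP[t0 t1].
    rewrite proj_linear projZ (le_trans (ler_normD _ _))// !normrZ (ger0_norm t0).
    rewrite ger0_norm ?subr_ge0//; move: y1 z1.
    set ny := `|kerproj y|; set nz := `|kerproj z|; nra.
  - exact: closed_proj_sublevel.
  rewrite /signed_vertex projZ /vertex !projD !projZ pa pb !scaler0 !addr0 proj_u.
  rewrite subr0 !normrZ normrX normrN1 expr1n mul1r.
  have [un _ _] := u_core; rewrite un mulr1.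
  have s0 := ltW (scale_gt0 R n./2); have s1 := scale_le1 R n./2.
  by rewrite ger0_norm ?gerBl ?sqr_ge0// subr_ge0 exprn_ile1.
by case=> [/(vert _ _ proj_e1 proj_e2)|/(vert _ _ proj_e2 proj_e1)] /=; rewrite subr0.
Qed.

Let A := minkowski_sum (summand u e1 e2) (summand u e2 e1).

(** One of the two summands is such that the functional of the slice is
    almost maximal on it at points u k + s e of a face; there u m can be
    chosen by the defining property of [daugavet_sequence], while v collects s e and a
    fixed point of the other summand. *)
Lemma sum_slice S : is_slice A S -> S !=set0 -> exists2 v, `|kerproj v| <= 1 &
  forall (l : seq nat) e, 0 < e -> exists2 m, S (u m + v) &
    `|\sum_(i <- l) u i| + 1 - e <= `|\sum_(i <- l) u i - u m|.
Proof.
move=> [h [r [/linear_functional hf _ r0 ->]]] [_ [[c1 C1 [c2 C2 <-]] cS]].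
set f : Y -> R := h in hf cS *.
pose d := f (c1 + c2) - (sup (f @` A) - r).
have d0 : 0 < d by rewrite subr_gt0.
have [_ _ uS] := u_core.
(* A point c of the summand on which f is governed by its face can be replaced
   by some u m + s a at a cost smaller than d, the depth of c1 + c2 in the
   slice. *)
have move_in a b c : `|f b| <= `|f a| -> summand u a b c -> exists s : R,
    forall (l : seq nat) e, 0 < e -> exists m, [/\ summand u a b (u m + s *: a),
      f c - d < f (u m + s *: a) &
      `|\sum_(i <- l) u i| + 1 - e <= `|\sum_(i <- l) u i - u m|].
  move=> fba Cc; have [s [s1 sP]] := summand_slice u_core hf fba.
  have d2 : 0 < d / 2 by rewrite divr_gt0.
  have [k kP] := sP c (d / 2) Cc d2.
  exists s => l e e0; pose e' := Num.min e (d / 4).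
  have e'0 : 0 < e' by rewrite lt_min e0 divr_gt0.
  have [m [fm lm]] := uS f k l e' hf e'0.
  have [e'e e'd] : e' <= e /\ e' <= d / 4 by split; rewrite ge_min lexx ?orbT.
  exists m; split; last by lra.
    have [f1 f2] := summand_face a b u_core m.
    by case: s1 => ->; rewrite ?scale1r ?scaleN1r.
  by rewrite (functionalD _ _ hf) (functionalZ _ _ hf); lra.
have [h21|/ltW h12] := lerP `|f e2| `|f e1|.
  have [s sP] := move_in _ _ _ h21 C1; exists (s *: e1 + c2).
    by rewrite projD projZ proj_e1 scaler0 add0r; apply: summand_proj; right.
  move=> l e /(sP l)[m [Cm fm lm]]; exists m => //; rewrite addrA; split.
    by exists (u m + s *: e1) => //; exists c2.
  by move: fm; rewrite /d -/f !(functionalD _ _ hf); lra.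
have [s sP] := move_in _ _ _ h12 C2; exists (s *: e2 + c1).
  by rewrite projD projZ proj_e2 scaler0 add0r; apply: summand_proj; left.
move=> l e /(sP l)[m [Cm fm lm]]; exists m => //; rewrite addrA [_ + c1]addrC; split.
  by exists c1 => //; exists (u m + s *: e2).
by move: fm; rewrite /d -/f !(functionalD _ _ hf); lra.
Qed.

(** A sequence of slices that is claimed to be determining yields points x n
    + v n, one in each slice, with x n chosen almost orthogonal to y n = u 0
    - x 0 - ... - x (n - 1).  Their hull misses a point of the sum. *)
Lemma sum_not_SCD : ~ SCD A.
Proof.
move=> [_ [U [U_slice [U_sub U_det]]]].
have [u1 uN _] := u_core.
have /choice[v vP] : forall n, exists v, `|kerproj v| <= 1 /\
    forall (l : seq nat) e, 0 < e -> exists2 m, U n (u m + v) &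
      `|\sum_(i <- l) u i| + 1 - e <= `|\sum_(i <- l) u i - u m|.
  by move=> n; have [v v1 vS] := sum_slice (U_slice n) (U_sub n).1; exists v.
have /choice[next nextP] : forall nl : nat * seq nat, exists m,
    U nl.1 (u m + v nl.1) /\
    `|\sum_(i <- nl.2) u i| + 1 - 2^-1 ^+ nl.1.+2 <=
    `|\sum_(i <- nl.2) u i - u m|.
  move=> [n l] /=; have [_ /(_ l (2^-1 ^+ n.+2))] := vP n.
  by case=> [|m Um lm]; [rewrite exprn_gt0// invr_gt0|exists m].
have /choice[opp oppP] := uN.
(* The terms of u with indices in l n sum up to u 0 - x 0 - ... - x (n - 1),
   since negatives of terms are again terms. *)
pose fix l n := if n is m.+1 then opp (next (m, l m)) :: l m else [:: 0%N].
pose x n := u (next (n, l n)).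
pose y n := \sum_(i <- l n) u i.
have y0 : y 0%N = u 0%N by rewrite /y /= big_seq1.
have yS n : y n.+1 = y n - x n by rewrite /y /= big_cons oppP addrC.
have y_ge n : n%:R + 2^-1 + 2^-1 ^+ n.+1 <= `|y n|.
  elim: n => [|n IH]; first by rewrite y0 u1 expr1; lra.
  have [_] := nextP (n, l n); rewrite /= -/(y n) -/(x n) -yS.
  have half : 2^-1 ^+ n.+2 = 2^-1 * 2^-1 ^+ n.+1 :> R by rewrite exprS.
  by rewrite half -[n.+1%:R]natr1; lra.
have y_dist n : `|u 0%N - y n| <= n%:R.
  elim: n => [|n IH]; first by rewrite y0 subrr normr0.
  rewrite yS opprB addrCA addrC -[n.+1%:R]natr1 (le_trans (ler_normD _ _))// lerD//.
  by rewrite u1.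
(* E contains every x n and is convex, because the condition for N implies the
   one for any larger N; E_far keeps E away from 2 u 0. *)
pose E : set Y := [set q | exists N, `|u 0%N - y N - q| <= N%:R - 1].
have E_mono q N M : (N <= M)%N -> `|u 0%N - y N - q| <= N%:R - 1 ->
    `|u 0%N - y M - q| <= M%:R - 1.
  move=> NM qN; elim: M NM => [|M IH]; first by rewrite leqn0 => /eqP N0; rewrite N0 in qN.
  rewrite leq_eqVlt => /predU1P[<-//|]; rewrite ltnS => /IH {}IH.
  have -> : u 0%N - y M.+1 - q = u 0%N - y M - q + x M.
    by rewrite yS opprB addrA [RHS]addrAC [u 0%N - y M + x M]addrAC.
  have := ler_normD (u 0%N - y M - q) (x M); rewrite u1 -[M.+1%:R]natr1; lra.
have E_far q : E q -> 2 <= `|2 *: u 0%N - q|.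
  move=> [N qN].
  have -> : 2 *: u 0%N - q = 2 *: y N + ((u 0%N - y N) + (u 0%N - y N - q)).
    by rewrite !scaler_nat !mulr2n addrACA subrKC [y N + (_ - q)]addrA subrKC addrA.
  have := lerB_normD (2 *: y N) ((u 0%N - y N) + (u 0%N - y N - q)).
  have := ler_normD (u 0%N - y N) (u 0%N - y N - q).
  rewrite normrZ ger0_norm//.
  have := y_dist N; have := y_ge N.
  have : 0 <= 2^-1 ^+ N.+1 :> R by rewrite exprn_ge0// invr_ge0.
  lra.
pose B : set Y := range (fun n => x n + v n).
pose t : Y := (u 0%N + e1) + (u 0%N + e2).
have At : A t.
  exists (u 0%N + e1); first by have [] := summand_face e1 e2 u_core 0%N.
  by exists (u 0%N + e2) => //; have [] := summand_face e2 e1 u_core 0%N.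
have : closed_convex_hull B t.
  apply: U_det At => n; exists (x n + v n); split; first by exists n.
  by have [] := nextP (n, l n).
have hull_sub : smallest (@convex_set R Y) B `<=`
    [set b | exists2 q, E q & `|kerproj b - q| <= 1].
  apply: smallest_sub => [|_ [n _ <-] /=].
    apply/convex_setP => a b s /= [q [N qN] aq] [p [M pM] bp] /andP[s0 s1].
    exists (s *: q + (1 - s) *: p).
      exists (maxn N M); have := E_mono _ _ _ (leq_maxl N M) qN.
      have := E_mono _ _ _ (leq_maxr N M) pM.
      move: (u 0%N - _) => z zp zq.
      have -> : z - (s *: q + (1 - s) *: p) = s *: (z - q) + (1 - s) *: (z - p).
        rewrite !scalerBr addrACA -opprD -[s *: z + _]scalerDl.
        by rewrite subrKC scale1r.
      rewrite (le_trans (ler_normD _ _))// !normrZ (ger0_norm s0) ger0_norm ?subr_ge0//.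
      move: zp zq; set na := `|z - p|; set nb := `|z - q|; nra.
    rewrite proj_linear projZ opprD addrACA -!scalerBr.
    rewrite (le_trans (ler_normD _ _))// !normrZ (ger0_norm s0) ger0_norm ?subr_ge0//.
    move: aq bp; set na := `|_ - _|; set nb := `|_ - p|; nra.
  exists (x n); last by rewrite projD /x proj_u addrAC subrr add0r; exact: (vP n).1.
  exists n.+1; rewrite yS opprB addrCA addrAC subrr add0r -[n.+1%:R]natr1 addrK.
  exact: y_dist.
have [k k0 kP] := proj_bounded.
move=> /closureP/(_ k^-1); rewrite invr_gt0 => /(_ k0)[b Bb tb].
have [q /E_far qE bq] := hull_sub _ Bb.
have pt : kerproj t = 2 *: u 0%N.
  by rewrite /t !projD proj_e1 proj_e2 proj_u !addr0 scaler_nat mulr2n.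
have := kP (t - b); rewrite projB pt => h1.
have h2 : k * `|t - b| < 1 by rewrite mulrC -ltr_pdivlMr ?div1r.
have := ler_normD (2 *: u 0%N - kerproj b) (kerproj b - q); rewrite addrA subrK; lra.
Qed.

(** Write x as the mean of three points, namely of its components along W,
    e1 and e2, each multiplied by 3. *)
Lemma summand_interior :
  (forall w, phi1 w = 0 -> phi2 w = 0 -> `|w| <= 1 ->
    closed_convex_hull (range u) w) ->
  interior (summand u e1 e2) !=set0.
Proof.
move=> ballW; set C := summand u e1 e2.
have /convex_setP cC : convex_set C by exact: cch_convex.
have CN x : C x -> C (- x) by exact: summand_sym.
have CZ (a : R) x : `|a| <= 1 -> C x -> C (a *: x).
  rewrite ler_norml => a1 Cx.
  have -> : a *: x = ((1 + a) / 2) *: x + (1 - (1 + a) / 2) *: (- x).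
    by rewrite scalerN -scalerBl; congr (_ *: _); field.
  by apply: cC => //; [exact: CN|lra].
have mid x y : C x -> C y -> C (2^-1 *: (x + y)).
  move=> Cx Cy; have := cC _ _ 2^-1 Cx Cy; rewrite scalerDr.
  have -> : 1 - 2^-1 = 2^-1 :> R by field.
  by apply; lra.
have half x : 2^-1 *: (x + x) = x :> Y.
  by rewrite -mulr2n -[x *+ 2]scaler_nat scalerA mulVf// scale1r.
have Cu k : C (u k).
  have [h1 h2] := summand_face e1 e2 u_core k.
  by rewrite -[u k]half; have := mid _ _ h1 h2; rewrite addrACA subrr addr0.
have Ce1 : C e1.
  have [_ uN _] := u_core; have [m mk] := uN 0%N.
  have [h1 _] := summand_face e1 e2 u_core 0%N.
  have [h2 _] := summand_face e1 e2 u_core m; rewrite mk in h2.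
  by rewrite -[e1]half; have := mid _ _ h1 h2; rewrite addrACA subrr add0r.
have Ce2 : C e2.
  have := @summand_vertex _ _ u e1 e2 0%N.
  by rewrite /vertex /scale expr0 expr1n subrr !scale0r !add0r scale1r.
have CW w : phi1 w = 0 -> phi2 w = 0 -> `|w| <= 1 -> C w.
  move=> w1 w2 /(ballW _ w1 w2); apply: cch_sub; [exact: cch_convex|exact: cch_closed|].
  by move=> _ [k _ <-]; exact: Cu.
have C3 x y z : C x -> C y -> C z -> C (3^-1 *: (x + (y + z))).
  move=> Cx Cy Cz.
  have -> : 3^-1 *: (x + (y + z)) = 3^-1 *: x + (1 - 3^-1) *: (2^-1 *: (y + z)).
    by rewrite scalerA scalerDr; congr (_ + _ *: _); field.
  by apply: cC => //; [exact: mid|lra].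
have [k k0 kP] := proj_bounded.
have [_ [k1 k1P]] := phi1_fun; have [_ [k2 k2P]] := phi2_fun.
pose K := k + `|k1| + `|k2|.
have K0 : 0 < K by rewrite /K -addrA ltr_pwDl// addr_ge0.
exists 0; apply/nbhs_ballP; exists (3 * K)^-1 => /=; first by rewrite invr_gt0 mulr_gt0.
move=> x; rewrite -ball_normE /= sub0r normrN -[_^-1]mul1r ltr_pdivlMr ?mulr_gt0// => /ltW xK.
have x3 : K * `|3 *: x| <= 1 by rewrite normrZ ger0_norm//; lra.
have bnd (c n : R) : n <= c * `|3 *: x| -> c <= K -> n <= 1.
  by move=> nc cK; rewrite (le_trans nc)// (le_trans _ x3)// ler_wpM2r.
have xE : x = 3^-1 *: (kerproj (3 *: x) + (phi1 (3 *: x) *: e1 + phi2 (3 *: x) *: e2)).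
  by rewrite /kerproj subrK scalerA mulVf// scale1r.
rewrite xE; apply: C3.
- have [p1 p2] := proj_kernel (3 *: x); apply: CW => //.
  by apply: bnd (kP _) _; rewrite /K -addrA lerDl addr_ge0.
- apply: CZ Ce1; apply: (bnd `|k1|); last by rewrite /K; have := normr_ge0 k2; lra.
  by rewrite (le_trans (k1P _))// ler_wpM2r// ler_norm.
- apply: CZ Ce2; apply: (bnd `|k2|); last by rewrite /K; have := normr_ge0 k1; lra.
  by rewrite (le_trans (k2P _))// ler_wpM2r// ler_norm.
Qed.

End Sum.

(** * Existence of the splitting and of the sequence *)

Section Final.
Variables (R : realType) (Y : normedModType R).

Lemma daugavet_unit (V : set Y) : linear_subspace V -> daugavet_in V ->
  exists2 x, V x & `|x| = 1.
Proof.
move=> sV DV.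
have n0 (x : Y) : `|0 : R| <= `|x| by rewrite normr0.
have z1 : `|0 : Y| <= 1 by rewrite normr0.
have [x [Vx x1 _ _]] :=
  daugavet_sphere 0 sV DV (@functional_zero R Y) n0 sV.1 z1 ltr01.
by exists x.
Qed.

(** Start from any unit vector e2 with a norming phi2, take e1 in the kernel
    of phi2, and correct a functional norming e1 by a multiple of phi2. *)
Lemma daugavet_splitting : Daugavet_property Y -> (exists y : Y, y != 0) ->
  exists (e1 e2 : Y) (phi1 phi2 : Y -> R),
  [/\ functional phi1 /\ functional phi2,
      phi1 e1 = 1 /\ phi1 e2 = 0, phi2 e1 = 0 /\ phi2 e2 = 1,
      linear_subspace [set x | phi1 x = 0 /\ phi2 x = 0] &
      daugavet_in [set x | phi1 x = 0 /\ phi2 x = 0]].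
Proof.
move=> DY Y0; have DT := daugavet_setT DY Y0.
have sT : linear_subspace [set: Y] by [].
have [e2 _ e21] := daugavet_unit sT DT.
have [phi2 [f2 _ phi2e2]] := norming e2; rewrite e21 in phi2e2.
have s1 := subspace_kernel sT f2; have D1 := daugavet_in_kernel sT f2 DT.
have [e1 [_ /= phi2e1] e11] := daugavet_unit s1 D1.
have [psi [fpsi _ psie1]] := norming e1; rewrite e11 in psie1.
pose phi1 x := psi x + - psi e2 * phi2 x.
have f1 : functional phi1 by exact: functional_comb.
have s2 := subspace_kernel s1 f1; have D2 := daugavet_in_kernel s1 f1 D1.
have E : [set: Y] `&` [set x | phi2 x = 0] `&` [set x | phi1 x = 0] =
    [set x | phi1 x = 0 /\ phi2 x = 0].
  by apply/seteqP; split=> x /=; [move=> [[_ ? ?]]|move=> [? ?]].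
rewrite E in s2 D2.
exists e1, e2, phi1, phi2; split=> //; split=> //.
  by rewrite /phi1 psie1 phi2e1 mulr0 addr0.
by rewrite /phi1 phi2e2 mulr1 subrr.
Qed.

Lemma separable_sequence : separable Y ->
  exists d : nat -> Y, forall x e, 0 < e -> exists n, `|x - d n| < e.
Proof.
move=> [D /countable_injP[f f_inj] D_dense].
have [d dP] : exists d : nat -> Y, forall a, D a -> exists n, d n = a.
  have /choice[d dP] : forall n, exists x, forall a, D a -> f a = n -> x = a.
    move=> n; have [[a [Da an]]|na] := pselect (exists a, D a /\ f a = n).
      exists a => b Db bn; apply: f_inj; rewrite ?inE ?an ?bn//.
    by exists 0 => a Da an; case: na; exists a.
  by exists d => a Da; exists (f a); exact: dP.
exists d => x e e0.
have [|a [xa Da]] := D_dense (ball x e) _ (ball_open x _).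
  by exists x; exact: ballxx.
  
have [n na] := dP _ Da; exists n.
by rewrite na; move: xa; rewrite -ball_normE.
Qed.

Variables (e1 e2 : Y) (phi1 phi2 : Y -> R).
Hypotheses (phi1_fun : functional phi1) (phi2_fun : functional phi2).
Hypotheses (phi1e1 : phi1 e1 = 1) (phi1e2 : phi1 e2 = 0).
Hypotheses (phi2e1 : phi2 e1 = 0) (phi2e2 : phi2 e2 = 1).
Let W : set Y := [set x | phi1 x = 0 /\ phi2 x = 0].
Hypotheses (W_sub : linear_subspace W) (W_daugavet : daugavet_in W).

Let P := kerproj e1 e2 phi1 phi2.

Lemma proj_id x : W x -> P x = x.
Proof. by move=> [x1 x2]; rewrite /P /kerproj x1 x2 !scale0r addr0 subr0. Qed.

(** Normalised projections of a dense sequence are dense in the unit sphere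
    of W, and the ball is spanned by opposite points of the sphere. *)
Lemma dense_daugavet_sequence : separable Y -> exists u : nat -> Y,
  [/\ daugavet_sequence u, forall n, W (u n) &
      forall w, W w -> `|w| <= 1 -> closed_convex_hull (range u) w].
Proof.
move=> /separable_sequence[d d_dense].
have [w0 Ww0 w01] := daugavet_unit W_sub W_daugavet.
(* The projection of d n may vanish; any unit vector of W then serves. *)
pose c n := if P (d n) == 0 then w0 else `|P (d n)|^-1 *: P (d n).
have cP n : W (c n) /\ `|c n| = 1.
  rewrite /c; case: eqVneq => [//|dn]; split.
    have PW : W (P (d n)).
      exact: (proj_kernel phi1_fun phi2_fun phi1e1 phi1e2 phi2e1 phi2e2 (d n)).
    exact: (subspaceZ _ W_sub PW).
  by rewrite normrZ normfV normr_id mulVf// normr_eq0.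
have [u [u_core uW uc]] := exists_daugavet_sequence W_sub W_daugavet cP.
exists u; split=> //.
have /convex_setP cK := @cch_convex _ _ (range u).
have unit w : W w -> `|w| = 1 -> closed_convex_hull (range u) w.
  move=> Ww w1; apply: cch_closed; apply/closureP => e e0.
  have [k k0 kP] := proj_bounded e1 e2 phi1_fun phi2_fun.
  pose r := Num.min 2^-1 (e / 3).
  have r0 : 0 < r by rewrite lt_min invr_gt0 ltr0n divr_gt0.
  have [r1 re] : r <= 2^-1 /\ r <= e / 3 by split; rewrite ge_min lexx ?orbT.
  have [n dn] := d_dense w _ (divr_gt0 r0 k0).
  have wr : `|w - P (d n)| <= r.
    rewrite -[w]proj_id// /P -projB// (le_trans (kP _))// mulrC -ler_pdivlMr//.
    exact: ltW.
  have Pn : 1 - r <= `|P (d n)| <= 1 + r.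
    have := ler_normB w (w - P (d n)); rewrite subKr w1.
    have := ler_normD (w - P (d n)) (P (d n)); rewrite subrK w1; lra.
  have Pn0 : 0 < `|P (d n)| by lra.
  have [m um] := uc n; exists (u m); first by apply: sub_cch; exists m.
  rewrite um /c; case: eqVneq => [Pn00|_]; first by rewrite Pn00 normr0 ltxx in Pn0.
  have Pc : `|P (d n) - `|P (d n)|^-1 *: P (d n)| <= r.
    have -> : P (d n) - `|P (d n)|^-1 *: P (d n) = (1 - `|P (d n)|^-1) *: P (d n).
      by rewrite scalerBl scale1r.
    have -> : 1 - `|P (d n)|^-1 = (`|P (d n)| - 1) / `|P (d n)| by field; rewrite gt_eqF.
    rewrite normrZ normrM normfV normr_id divfK ?gt_eqF// ler_norml; lra.
  have := ler_normD (w - P (d n)) (P (d n) - `|P (d n)|^-1 *: P (d n)).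
  rewrite addrA subrK; lra.
move=> w Ww w1; have [w00|wn0] := eqVneq w 0.
  have [_ uN _] := u_core; have [m mE] := uN 0%N.
  have := cK (u 0%N) (u m) 2^-1 (sub_cch (ex_intro2 _ _ 0%N I erefl))
    (sub_cch (ex_intro2 _ _ m I erefl)).
  rewrite mE w00 scalerN -scalerBl.
  have -> : 2^-1 - (1 - 2^-1) = 0 :> R by field.
  by rewrite scale0r; apply; lra.
have nw : 0 < `|w| by rewrite normr_gt0.
pose x := `|w|^-1 *: w.
have Wx : W x by exact: subspaceZ.
have x1 : `|x| = 1 by rewrite normrZ normfV normr_id mulVf ?gt_eqF.
have -> : w = ((1 + `|w|) / 2) *: x + (1 - (1 + `|w|) / 2) *: (- x).
  rewrite scalerN -scalerBl scalerA -[LHS]scale1r; congr (_ *: _).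
  by field; rewrite gt_eqF.
by apply: cK; [exact: unit|apply: unit; rewrite ?normrN//; exact: subspaceN|lra].
Qed.

End Final.

Theorem theorem3p6 (R : realType) (Y : completeNormedModType R)
    (Y_neq0 : exists y : Y, y != 0) (Y_Daugavet : Daugavet_property Y) :
  (exists C1 C2 : set Y,
    [/\ convex_closed_bounded_symmetric C1,
        convex_closed_bounded_symmetric C2,
        SCD C1, SCD C2 & ~ SCD (minkowski_sum C1 C2)]) /\
  (separable Y ->
    exists C1 C2 : set Y,
      [/\ convex_closed_bounded_symmetric C1 /\ interior C1 !=set0,
          convex_closed_bounded_symmetric C2 /\ interior C2 !=set0,
          SCD C1, SCD C2 & ~ SCD (minkowski_sum C1 C2)]).
Proof.
have [e1 [e2 [phi1 [phi2 [[f1 f2] [f11 f12] [f21 f22] sW DW]]]]] :=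
  daugavet_splitting Y_Daugavet Y_neq0.
have [w0 Ww0 w01] := daugavet_unit sW DW.
split=> [|Y_sep].
  have [u [uc uW _]] := exists_daugavet_sequence sW DW (fun=> conj Ww0 w01).
  have u1 n := (uW n).1; have u2 n := (uW n).2.
  exists (summand u e1 e2), (summand u e2 e1); split.
  - exact: summand_ccbs.
  - exact: summand_ccbs.
  - exact: (summand_SCD uc f1 f2).
  - exact: (summand_SCD uc f2 f1).
  - exact: (sum_not_SCD uc f1 f2).
have [u [uc uW uball]] := dense_daugavet_sequence f1 f2 f11 f12 f21 f22 sW DW Y_sep.
have u1 n := (uW n).1; have u2 n := (uW n).2.
exists (summand u e1 e2), (summand u e2 e1); split.
- split; first exact: summand_ccbs.
  by apply: (summand_interior uc f1 f2) => // w w1 w2; exact: uball.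
- split; first exact: summand_ccbs.
  by apply: (summand_interior uc f2 f1) => // w w1 w2; exact: uball.
- exact: (summand_SCD uc f1 f2).
- exact: (summand_SCD uc f2 f1).
- exact: (sum_not_SCD uc f1 f2).
Qed.
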